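(* Let $S$ be a relatively compact subset of $\mathrm{GL}_d(\mathbb{R})$. (1) Suppose that there exist $n\in\mathbb{N}$ and constants $r\geq\varepsilon>0$ such that $S^n$ is an $(r,\varepsilon)$-Schottky family. Then $S$ is $1$-dominated. (2) Suppose $S$ is $1$-dominated. Then there exists $r>0$ such that for every $\varepsilon\in(0,r)$ there is $n_\varepsilon\in\mathbb{N}$ such that the semigroup $\bigcup_{n\geq n_\varepsilon}S^n$ is an $(r,\varepsilon)$-Schottky family.
   Context: For $n\geq1$, $S^n:=\{g_1\cdots g_n:g_i\in S\}$. For $g\in \mathrm{GL}_d(\mathbb{R})$, $a_1(g)\geq a_2(g)\geq\dots\geq a_d(g)>0$ denote its singular values. A relatively compact subset $S\subset \mathrm{GL}_d(\mathbb{R})$ is $1$-dominated if there is $\varepsilon>0$ such that for every large enough $n\in\mathbb{N}$ and every $g\in S^n$, $\frac{a_2(g)}{a_1(g)}\leq(1-\varepsilon)^n$. The projective space $\mathbb{P}(\mathbb{R}^d)$ carries the distance $d([x],[y])=\frac{\|x\wedge y\|}{\|x\|\,\|y\|}$, where $\|\cdot\|$ is a Euclidean norm on $\mathbb{R}^d$ and the induced Euclidean norm on $\bigwedge^2\mathbb{R}^d$. A linear map $g$ is proximal if it has a unique eigenvalue of maximal modulus (counted with multiplicity, so that it is simple); then $v_g^+\in\mathbb{P}(\mathbb{R}^d)$ denotes the corresponding eigenline and $H_g^<\subset\mathbb{P}(\mathbb{R}^d)$ the (projective) supplementary $g$-invariant hyperplane. For $0<\varepsilon\leq r$, a proximal $g$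 is $(r,\varepsilon)$-proximal if $d(v_g^+,H_g^<)\geq2r$ and $d(gx,gy)\leq\varepsilon\, d(x,y)$ for all $x,y\in\mathbb{P}(\mathbb{R}^d)$ with $d(x,H_g^<)\geq\varepsilon$ and $d(y,H_g^<)\geq\varepsilon$. A subset $E\subset \mathrm{GL}_d(\mathbb{R})$ is an $(r,\varepsilon)$-Schottky family if every $\gamma\in E$ is $(r,\varepsilon)$-proximal and $d(v_\gamma^+,H_{\gamma'}^<)\geq6r$ for all $\gamma,\gamma'\in E$. *)

(* Defs.v *)
From HB Require Import structures.
From mathcomp Require Import all_boot all_order all_algebra.
From mathcomp.real_closed Require Import complex.
From mathcomp Require Import boolp classical_sets reals topology normedtype.

Set Implicit Arguments.
Unset Strict Implicit.
Unset Printing Implicit Defensive.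

Import Order.TTheory GRing.Theory Num.Theory.
Import numFieldNormedType.Exports.

Local Open Scope classical_set_scope.
Local Open Scope ring_scope.

(* Complex eigenvalues of a real matrix, listed with algebraic multiplicity. *)
Definition eigenvalues (R : realType) (d : nat) (g : 'M[R]_d) : seq R[i] :=
  sval (closed_field_poly_normal (char_poly (map_mx (real_complex R) g))).

(* Nonincreasing list of the square roots of the eigenvalues of g^T g, which
   are real and nonnegative. *)
Definition singular_values (R : realType) (d : nat) (g : 'M[R]_d) : seq R :=
  sort (fun x y => y <= x)
    [seq Num.sqrt (complex.Re z) | z <- eigenvalues (g^T *m g)].

(* Indexed from 1: [singular_value i g] is a_i(g). *)
Definition singular_value (R : realType) (d : nat) (i : nat) (g : 'M[R]_d) : R :=
  nth 0 (singular_values g) i.-1.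

Definition GL {R : realType} {d : nat} : set 'M[R]_d :=
  [set g | g \in unitmx].

(* The closure of S relative to GL is compact. *)
Definition relatively_compact_in_GL (R : realType) (d : nat)
    (S : set 'M[R]_d) : Prop :=
  S `<=` GL /\ compact (closure S `&` GL).

(* Meaningful for n >= 1; the value at n = 0 is {1}. *)
Definition set_power (R : realType) (d : nat) (S : set 'M[R]_d) (n : nat) :
    set 'M[R]_d :=
  [set g | exists h : 'I_n -> 'M[R]_d,
     (forall i, S (h i)) /\ g = \big[mulmx/1%:M]_(i < n) h i].

Definition one_dominated (R : realType) (d : nat) (S : set 'M[R]_d) : Prop :=
  exists e : R, 0 < e /\
    \forall n \near \oo, forall g, set_power S n g ->
      singular_value 2 g / singular_value 1 g <= (1 - e) ^+ n.

(* A Euclidean norm on R^d is given by the Gram matrix Q of its inner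
   product. *)
Definition dot (R : realType) (d : nat) (Q : 'M[R]_d) (x y : 'cV[R]_d) : R :=
  (x^T *m Q *m y) 0 0.

Definition inner_product_matrix (R : realType) (d : nat) (Q : 'M[R]_d) : Prop :=
  Q^T = Q /\ forall x : 'cV[R]_d, x != 0 -> 0 < dot Q x x.

Definition enorm (R : realType) (d : nat) (Q : 'M[R]_d) (x : 'cV[R]_d) : R :=
  Num.sqrt (dot Q x x).

(* Norm of x /\ y for the induced inner product on the exterior square,
   <x /\ y, z /\ w> = <x, z> <y, w> - <x, w> <y, z>. *)
Definition wedge_norm (R : realType) (d : nat) (Q : 'M[R]_d)
    (x y : 'cV[R]_d) : R :=
  Num.sqrt (dot Q x x * dot Q y y - dot Q x y * dot Q y x).

(* Points of P(R^d) are the lines of R^d; [proj U] is the projective subspace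
   P(U), and P(R^d) itself is [proj fullv]. *)
Definition proj (R : realType) (d : nat) (U : {vspace 'cV[R]_d}) :
    set {vspace 'cV[R]_d} :=
  [set L | \dim L = 1%N /\ (L <= U)%VS].

(* [vpick L] is a nonzero vector of the line L; the quotient does not depend
   on which one. *)
Definition pdist (R : realType) (d : nat) (Q : 'M[R]_d)
    (L M : {vspace 'cV[R]_d}) : R :=
  wedge_norm Q (vpick L) (vpick M) /
    (enorm Q (vpick L) * enorm Q (vpick M)).

Definition pdist_set (R : realType) (d : nat) (Q : 'M[R]_d)
    (L : {vspace 'cV[R]_d}) (A : set {vspace 'cV[R]_d}) : R :=
  inf [set pdist Q L M | M in A].

Definition lin (R : realType) (d : nat) (g : 'M[R]_d) : 'End('cV[R]_d) :=
  linfun (mulmx g).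

Definition dominant_eigenvalue (R : realType) (d : nat) (g : 'M[R]_d)
    (z : R[i]) : Prop :=
  exists s : seq R[i], perm_eq (eigenvalues g) (z :: s) /\
    forall w, w \in s -> `|w| < `|z|.

Definition proximal (R : realType) (d : nat) (g : 'M[R]_d) : Prop :=
  exists z : R[i], dominant_eigenvalue g z.

(* The dominant eigenvalue of a proximal real matrix is unique and real, since
   complex conjugation permutes the eigenvalues. *)
Definition attracting_line (R : realType) (d : nat) (g : 'M[R]_d) :
    {vspace 'cV[R]_d} :=
  xget 0%VS [set L | exists a : R,
    dominant_eigenvalue g (real_complex R a) /\ L = passmx.leigenspace (lin g) a].

(* For proximal g there is exactly one invariant complement. *)
Definition repelling_hyperplane (R : realType) (d : nat) (g : 'M[R]_d) :
    {vspace 'cV[R]_d} :=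
  xget 0%VS [set H | [/\ (lin g @: H <= H)%VS,
    (attracting_line g :&: H = 0)%VS & (attracting_line g + H = fullv)%VS]].

Definition pdist_repelling (R : realType) (d : nat) (Q : 'M[R]_d)
    (L : {vspace 'cV[R]_d}) (g : 'M[R]_d) : R :=
  pdist_set Q L (proj (repelling_hyperplane g)).

Definition r_eps_proximal (R : realType) (d : nat) (Q : 'M[R]_d) (r e : R)
    (g : 'M[R]_d) : Prop :=
  [/\ proximal g,
      2 * r <= pdist_repelling Q (attracting_line g) g &
      forall x y, proj fullv x -> proj fullv y ->
        e <= pdist_repelling Q x g -> e <= pdist_repelling Q y g ->
        pdist Q (lin g @: x) (lin g @: y) <= e * pdist Q x y].

Definition schottky_family (R : realType) (d : nat) (Q : 'M[R]_d) (r e : R)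
    (E : set 'M[R]_d) : Prop :=
  (forall g, E g -> r_eps_proximal Q r e g) /\
  (forall g h, E g -> E h ->
     6 * r <= pdist_repelling Q (attracting_line g) h).

(* Main.v *)
From HB Require Import structures.
Require Import Defs.
From mathcomp Require Import all_boot all_order all_algebra fingroup perm.
From mathcomp.real_closed Require Import complex polyrcf.
From mathcomp Require Import boolp classical_sets reals topology normedtype sequences.
From mathcomp Require Import ring lra.

Set Implicit Arguments.
Unset Strict Implicit.
Unset Printing Implicit Defensive.

Import Order.TTheory GRing.Theory Num.Theory.
Import numFieldNormedType.Exports.

Local Open Scope classical_set_scope.
Local Open Scope ring_scope.

(** Throughout, distances between lines are sines of angles, and g in a power of S is
    compared with the leading term of its singular value decomposition: g is
    a_1(g) u w^T up to an error of relative size a_2(g) / a_1(g), where u and w are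
    the top left and right singular vectors. So g sends lines away from the hyperplane
    orthogonal to w close to the line of u, and it contracts there at rate
    a_2(g) / a_1(g).

    Schottky implies dominated. If T = S^n is a Schottky family, then the lines at
    distance at least e from every repelling hyperplane form a set that T maps into
    itself ([contracting_domain_invariant]): an image lies within e of an attracting
    line, hence far from all the repelling hyperplanes. This set contains a ball, and a
    product of k elements of T contracts it by the factor e^k. Among the vectors of a
    ball there are always two, moved along the two top right singular vectors of g,
    whose images have an angle at least of the order of a_2(g) / a_1(g)
    ([singular_ratio_le]). Hence a_2 / a_1 = O(e^k) on S^(nk), and the at most n - 1
    remaining letters cost only a bounded factor.

    Dominated implies Schottky. The heart is [transversality]: |<w(G), u(A)>| is bounded
    below uniformly over all long words G and A. This number, called beta below, is
    |GA| / (|G| |A|) up to an exponentially small error. Moving a letter across the cut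
    between G and A does not change GA and changes |G| |A| by a bounded factor; and
    u(A) and w(G) depend, up to exponentially small errors, only on the letters close
    to the cut. So if beta were tiny at one cut of a long word, it would be tiny at all
    the cuts of a long subword P and of all its subwords. Cutting P dyadically, each of
    the log |P| levels multiplies the bound of the norm of P by tau^(|P| / 3), so that
    the norm of P is superexponentially small, whereas the inverses of the letters
    are bounded.

    Given transversality, a long word g is nearly of rank one with <w, u> away from 0,
    so it has a real eigenvalue of size comparable to a_1(g)
    ([near_rank_one_eigenvalue]). The corresponding right and left eigenvectors v and l
    are close to u and w, the repelling hyperplane is the orthogonal of l, and every
    other eigenvalue is smaller because g contracts that hyperplane
    ([near_rank_one_attractor]). The separation of attracting lines from repelling
    hyperplanes is then transversality again, and the contraction rate on lines at
    distance e from the hyperplane is of the order of a_2(g) / (a_1(g) e^2)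
    ([sine_contraction]). *)

(** * Geometry of an inner product *)

Section InnerProduct.
Variables (R : realType) (d : nat) (Q : 'M[R]_d).
Hypothesis hQ : inner_product_matrix Q.
Implicit Types (x y z w : 'cV[R]_d) (a b t : R).

Local Notation "''[' x , y ]" := (dot Q x y) (format "''[' x ,  y ]").
Local Notation "''N' ( x )" := (enorm Q x) (format "''N' ( x )").

Lemma dotC x y : '[x, y] = '[y, x].
Proof.
rewrite /dot; have -> : x^T *m Q *m y = (y^T *m Q *m x)^T.
  by rewrite !trmx_mul trmxK (proj1 hQ) mulmxA.
by rewrite mxE.
Qed.

Lemma dotDr x y z : '[x, y + z] = '[x, y] + '[x, z].
Proof. by rewrite /dot mulmxDr mxE. Qed.

Lemma dotDl x y z : '[y + z, x] = '[y, x] + '[z, x].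
Proof. by rewrite !(dotC _ x) dotDr. Qed.

Lemma dotZr a x y : '[x, a *: y] = a * '[x, y].
Proof. by rewrite /dot -scalemxAr mxE. Qed.

Lemma dotZl a x y : '[a *: x, y] = a * '[x, y].
Proof. by rewrite !(dotC _ y) dotZr. Qed.

Lemma dotNr x y : '[x, - y] = - '[x, y].
Proof. by rewrite -scaleN1r dotZr mulN1r. Qed.

Lemma dotNl x y : '[- x, y] = - '[x, y].
Proof. by rewrite -scaleN1r dotZl mulN1r. Qed.

Lemma dot0r x : '[x, 0] = 0.
Proof. by rewrite -(scale0r 0) dotZr mul0r. Qed.

Lemma dot0l x : '[0, x] = 0.
Proof. by rewrite dotC dot0r. Qed.

Definition dotE := (dotDr, dotDl, dotZr, dotZl, dotNr, dotNl, dot0r, dot0l).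

Lemma dot_ge0 x : 0 <= '[x, x].
Proof.
have [->|x0] := eqVneq x 0; first by rewrite dot0r.
by rewrite ltW // (proj2 hQ).
Qed.

Lemma enorm_ge0 x : 0 <= 'N(x).
Proof. exact: sqrtr_ge0. Qed.

Lemma enorm_sq x : 'N(x) ^+ 2 = '[x, x].
Proof. by rewrite sqr_sqrtr // dot_ge0. Qed.

Lemma enorm_gt0 x : (0 < 'N(x)) = (x != 0).
Proof.
have [->|x0] := eqVneq x 0; first by rewrite /enorm dot0r sqrtr0 ltxx.
by rewrite sqrtr_gt0 (proj2 hQ).
Qed.

Lemma enorm_eq0 x : ('N(x) == 0) = (x == 0).
Proof.
by have := enorm_gt0 x; rewrite lt_neqAle enorm_ge0 andbT eq_sym => /negb_inj.
Qed.

Lemma enorm0 : 'N(0 : 'cV[R]_d) = 0.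
Proof. by apply/eqP; rewrite enorm_eq0. Qed.

Lemma enormZ a x : 'N(a *: x) = `|a| * 'N(x).
Proof.
apply/eqP; rewrite -(@eqrXn2 _ 2) ?mulr_ge0 ?enorm_ge0 //.
by rewrite exprMn !enorm_sq !dotE real_normK ?num_real // mulrA expr2.
Qed.

Lemma enormN x : 'N(- x) = 'N(x).
Proof. by rewrite -scaleN1r enormZ normrN1 mul1r. Qed.

Lemma dot_sq_le x y : '[x, y] ^+ 2 <= '[x, x] * '[y, y].
Proof.
have [->|y0] := eqVneq y 0; first by rewrite !dot0r expr0n mulr0.
have yy : 0 < '[y, y] by rewrite (proj2 hQ).
have := dot_ge0 ('[y, y] *: x - '[x, y] *: y).
rewrite !dotE (dotC y x) => h.
rewrite -subr_ge0 -(pmulr_rge0 _ yy).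
by apply: le_trans h _; rewrite le_eqVlt; apply/orP; left; apply/eqP; ring.
Qed.

Lemma cauchy_schwarz x y : `|'[x, y]| <= 'N(x) * 'N(y).
Proof.
rewrite -(@ler_pXn2r _ 2) ?nnegrE ?mulr_ge0 ?enorm_ge0 //.
by rewrite exprMn !enorm_sq real_normK ?num_real // dot_sq_le.
Qed.

Lemma enormD x y : 'N(x + y) <= 'N(x) + 'N(y).
Proof.
rewrite -(@ler_pXn2r _ 2) ?nnegrE ?addr_ge0 ?enorm_ge0 //.
rewrite sqrrD !enorm_sq !dotE (dotC y x).
have := le_trans (ler_norm _) (cauchy_schwarz x y).
by set c := '[x, y]; set p := 'N(x) * _; move=> h; rewrite mulr2n; lra.
Qed.

Lemma enormBD x y : 'N(x - y) <= 'N(x) + 'N(y).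
Proof. by rewrite -(enormN y) enormD. Qed.

Lemma enorm_rev x y : 'N(x) - 'N(y) <= 'N(x + y).
Proof. by rewrite lerBlDr -{1}(addrK y x) enormBD. Qed.

Lemma wedge_ge0 x y : 0 <= wedge_norm Q x y.
Proof. exact: sqrtr_ge0. Qed.

Lemma wedge_sq x y :
  wedge_norm Q x y ^+ 2 = '[x, x] * '[y, y] - '[x, y] ^+ 2.
Proof.
rewrite /wedge_norm (dotC y x) -expr2 sqr_sqrtr //.
by rewrite subr_ge0 dot_sq_le.
Qed.

Lemma wedgeC x y : wedge_norm Q x y = wedge_norm Q y x.
Proof. by rewrite /wedge_norm (dotC y x); congr Num.sqrt; ring. Qed.

Lemma wedge_eq x y x' y' a : wedge_norm Q x y ^+ 2 = (a * wedge_norm Q x' y') ^+ 2 ->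
  wedge_norm Q x y = `|a| * wedge_norm Q x' y'.
Proof.
move=> h; apply/eqP; rewrite -(@eqrXn2 _ 2) ?mulr_ge0 ?wedge_ge0 //.
by rewrite h !exprMn real_normK ?num_real.
Qed.

Lemma wedge_combine x y a b :
  wedge_norm Q x (a *: x + b *: y) = `|b| * wedge_norm Q x y.
Proof. by apply: wedge_eq; rewrite exprMn !wedge_sq !dotE (dotC y x); ring. Qed.

Lemma wedge_shift x y t : wedge_norm Q (x - t *: y) y = wedge_norm Q x y.
Proof.
rewrite wedgeC addrC -scaleNr -[x in _ + x]scale1r wedge_combine.
by rewrite normr1 mul1r wedgeC.
Qed.

Lemma wedgeZ a b x y :
  wedge_norm Q (a *: x) (b *: y) = `|a * b| * wedge_norm Q x y.
Proof. by apply: wedge_eq; rewrite exprMn !wedge_sq !dotE; ring. Qed.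

Lemma wedge_le x y : wedge_norm Q x y <= 'N(x) * 'N(y).
Proof.
rewrite -(@ler_pXn2r _ 2) ?nnegrE ?mulr_ge0 ?enorm_ge0 ?wedge_ge0 //.
by rewrite exprMn wedge_sq !enorm_sq gerBl sqr_ge0.
Qed.

(** The norm of x /\ y is base times height: |y| times the distance from x to the line
    of y. The lemmas below use exterior squares only through this description. *)
Lemma wedge_le_height x y t : wedge_norm Q x y <= 'N(x - t *: y) * 'N(y).
Proof. by rewrite -(wedge_shift x y t) wedge_le. Qed.

Lemma wedge_height x y : y != 0 -> exists t,
  [/\ wedge_norm Q x y = 'N(x - t *: y) * 'N(y), '[x - t *: y, y] = 0 &
      `|t| * 'N(y) <= 'N(x) ].
Proof.
move=> y0; have yy : '[y, y] != 0 by rewrite gt_eqF // (proj2 hQ).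
exists ('[x, y] / '[y, y]).
have o : '[x - ('[x, y] / '[y, y]) *: y, y] = 0 by rewrite !dotE divfK // subrr.
split=> //.
  rewrite -(wedge_shift x y ('[x, y] / '[y, y])); apply/eqP.
  rewrite -(@eqrXn2 _ 2) ?mulr_ge0 ?enorm_ge0 ?wedge_ge0 //.
  by rewrite wedge_sq o exprMn !enorm_sq expr0n subr0.
rewrite normrM normfV (ger0_norm (dot_ge0 y)) -enorm_sq.
have ny : 0 < 'N(y) by rewrite enorm_gt0.
rewrite expr2 invfM !mulrA divfK ?gt_eqF // ler_pdivrMr //.
exact: cauchy_schwarz.
Qed.

(** The vector on the left is the interior product of x /\ y with w, so it is bounded
    by |w| |x /\ y|. It does not change when a multiple of y is subtracted from x; for
    x orthogonal to y each of the two terms satisfies the bound, whence the 2. *)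
Lemma wedge_contract w x y :
  'N('[w, x] *: y - '[w, y] *: x) <= 2 * 'N(w) * wedge_norm Q x y.
Proof.
have [->|y0] := eqVneq y 0.
  rewrite dot0r scaler0 scale0r subrr enorm0.
  by rewrite !mulr_ge0 ?enorm_ge0 ?wedge_ge0.
have [t [-> _ _]] := wedge_height x y0; set z := x - t *: y.
have -> : '[w, x] *: y - '[w, y] *: x = '[w, z] *: y - '[w, y] *: z.
  by rewrite /z !dotE; apply/matrixP=> i j; rewrite !mxE; ring.
apply: le_trans (enormBD _ _) _; rewrite !enormZ.
have h1 := ler_wpM2r (enorm_ge0 y) (cauchy_schwarz w z).
have h2 := ler_wpM2r (enorm_ge0 z) (cauchy_schwarz w y).
apply: le_trans (lerD h1 h2) _.
by rewrite le_eqVlt; apply/orP; left; apply/eqP; ring.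
Qed.

(** The function [pdist] on the lines spanned by x and y. *)
Definition sine x y : R := wedge_norm Q x y / ('N(x) * 'N(y)).

Lemma sineC x y : sine x y = sine y x.
Proof. by rewrite /sine wedgeC [X in _ / X]mulrC. Qed.

Lemma sine_ge0 x y : 0 <= sine x y.
Proof. by rewrite divr_ge0 ?wedge_ge0 ?mulr_ge0 ?enorm_ge0. Qed.

Lemma sine_le1 x y : sine x y <= 1.
Proof.
rewrite /sine; have [->|x0] := eqVneq x 0; first by rewrite enorm0 mul0r invr0 mulr0.
have [->|y0] := eqVneq y 0; first by rewrite enorm0 mulr0 invr0 mulr0.
by rewrite ler_pdivrMr ?mul1r ?wedge_le // mulr_gt0 // enorm_gt0.
Qed.

Lemma sineZ a b x y : a != 0 -> b != 0 -> sine (a *: x) (b *: y) = sine x y.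
Proof.
move=> a0 b0; rewrite /sine wedgeZ !enormZ normrM mulrACA.
by rewrite -mulf_div divff ?mul1r // mulf_neq0 // normr_eq0.
Qed.

Lemma sine_le_height x y t : y != 0 -> sine x y <= 'N(x - t *: y) / 'N(x).
Proof.
move=> y0; have [->|x0] := eqVneq x 0.
  by rewrite /sine enorm0 mul0r invr0 !mulr0.
have nx : 0 < 'N(x) by rewrite enorm_gt0.
have ny : 0 < 'N(y) by rewrite enorm_gt0.
rewrite /sine ler_pdivrMr ?mulr_gt0 // mulrA divfK ?gt_eqF //.
exact: wedge_le_height.
Qed.

Lemma sine_height x y : x != 0 -> y != 0 -> exists t,
  sine x y = 'N(x - t *: y) / 'N(x) /\ `|t| * 'N(y) <= 'N(x).
Proof.
move=> x0 y0; have [t [h _ ht]] := wedge_height x y0; exists t; split=> //.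
have nx : 0 < 'N(x) by rewrite enorm_gt0.
have ny : 0 < 'N(y) by rewrite enorm_gt0.
by rewrite /sine h invfM mulrA mulrAC mulfK // gt_eqF.
Qed.

(** Approximate x by a multiple t y and y by a multiple s z; then t s z approximates x,
    and the error of the second step is not magnified because |t y| <= |x|. *)
Lemma sine_triangle x y z : x != 0 -> y != 0 -> z != 0 ->
  sine x z <= sine x y + sine y z.
Proof.
move=> x0 y0 z0.
have nx : 0 < 'N(x) by rewrite enorm_gt0.
have ny : 0 < 'N(y) by rewrite enorm_gt0.
have [t [-> ht]] := sine_height x0 y0.
have [s [-> _]] := sine_height y0 z0.
apply: le_trans (sine_le_height x (t * s) z0) _.
have -> : x - (t * s) *: z = (x - t *: y) + t *: (y - s *: z).
  by rewrite scalerBr scalerA addrA subrK.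
rewrite ler_pdivrMr // mulrDl divfK ?gt_eqF //.
apply: le_trans (enormD _ _) _; rewrite lerD2l enormZ.
rewrite [leLHS]mulrC -mulrA ler_wpM2l ?enorm_ge0 //.
by rewrite mulrC ler_pdivlMr.
Qed.

End InnerProduct.

(** * Eigenvalues and singular values *)

Local Notation "''[' x , y ]" := (dot 1%:M x y) (format "''[' x ,  y ]").
Local Notation "''N' ( x )" := (enorm 1%:M x) (format "''N' ( x )").

Section Standard.
Variables (R : realType).

Lemma standard_dotE n (x y : 'cV[R]_n) : '[x, y] = (x^T *m y) 0 0.
Proof. by rewrite /dot mulmx1. Qed.

Lemma standard_sum n (x : 'cV[R]_n) : '[x, x] = \sum_i x i 0 ^+ 2.
Proof. by rewrite standard_dotE mxE; apply: eq_bigr => i _; rewrite mxE expr2. Qed.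

Lemma standard_inner_product n : @inner_product_matrix R n 1%:M.
Proof.
split=> [|x x0]; first by rewrite trmx1.
rewrite standard_sum lt0r sumr_ge0 ?andbT => [|i _]; last exact: sqr_ge0.
apply: contra x0; rewrite psumr_eq0 => [/allP h|i _]; last exact: sqr_ge0.
apply/eqP/matrixP => i j; rewrite ord1 mxE.
by have := h i; rewrite mem_index_enum sqrf_eq0 => /(_ isT)/eqP.
Qed.

Lemma dot_trmx n m (A : 'M[R]_(n, m)) x y : '[A *m x, y] = '[x, A^T *m y].
Proof. by rewrite !standard_dotE trmx_mul mulmxA. Qed.

End Standard.

Local Notation ip1 := (@standard_inner_product _ _).

Section Eigenvalues.
Variables (R : realType).

Lemma char_poly_eigenvalues n (A : 'M[R]_n) :
  char_poly (map_mx (real_complex R) A) = \prod_(z <- eigenvalues A) ('X - z%:P).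
Proof.
rewrite /eigenvalues; case: closed_field_poly_normal => s /= {1}->.
by rewrite (monicP (char_poly_monic _)) scale1r.
Qed.

Lemma eigenvalues_perm n (A : 'M[R]_n) s :
  char_poly (map_mx (real_complex R) A) = \prod_(z <- s) ('X - z%:P) ->
  perm_eq (eigenvalues A) s.
Proof. by move=> h; apply: prod_XsubC_eq; rewrite -char_poly_eigenvalues. Qed.

Lemma mem_eigenvalues n (A : 'M[R]_n) z :
  (z \in eigenvalues A) = root (char_poly (map_mx (real_complex R) A)) z.
Proof. by rewrite char_poly_eigenvalues root_prod_XsubC. Qed.

Lemma char_poly_tr (F : comNzRingType) n (A : 'M[F]_n) :
  char_poly A^T = char_poly A.
Proof.
rewrite /char_poly -det_tr; congr (\det _).
by rewrite /char_poly_mx linearB /= tr_scalar_mx -map_trmx trmxK.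
Qed.

(** A complex eigenvector p + iq, written in real terms. *)
Lemma complex_eigenvector n (A : 'M[R]_n) z : z \in eigenvalues A ->
  exists p q : 'cV[R]_n, [/\ 0 < '[p, p] + '[q, q],
    A *m p = complex.Re z *: p - complex.Im z *: q &
    A *m q = complex.Im z *: p + complex.Re z *: q].
Proof.
rewrite mem_eigenvalues -char_poly_tr -eigenvalue_root_char map_trmx.
case/eigenvalueP => v hv v0.
pose p : 'cV[R]_n := \col_i complex.Re (v 0 i).
pose q : 'cV[R]_n := \col_i complex.Im (v 0 i).
have hi i : \sum_j (real_complex R (A i j)) * v 0 j = z * v 0 i.
  move/matrixP/(_ 0 i): hv; rewrite !mxE => <-.
  by apply: eq_bigr => j _; rewrite !mxE mulrC.
have ReD (I : finType) (F : I -> R[i]) :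
    complex.Re (\sum_i F i) = \sum_i complex.Re (F i).
  by apply: (big_morph (@complex.Re R)) => //; case=> ? ? [? ?].
have ImD (I : finType) (F : I -> R[i]) :
    complex.Im (\sum_i F i) = \sum_i complex.Im (F i).
  by apply: (big_morph (@complex.Im R)) => //; case=> ? ? [? ?].
exists p, q; split.
- rewrite lt0r addr_ge0 ?(dot_ge0 ip1) // andbT.
  apply: contra v0; rewrite paddr_eq0 ?(dot_ge0 ip1) //.
  rewrite -!(enorm_sq ip1) !sqrf_eq0 !(enorm_eq0 ip1).
  case/andP => /eqP/matrixP p0 /eqP/matrixP q0; apply/eqP/rowP => i.
  move: (p0 i 0) (q0 i 0); rewrite !mxE; case: (v 0 i) => a b /= -> ->.
  by [].
- apply/matrixP=> i j; rewrite !mxE.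
  have := congr1 (@complex.Re R) (hi i); rewrite ReD.
  case: (z) (v 0 i) => a b [c e] /= <-.
  by apply: eq_bigr => k _; rewrite !mxE; case: (v 0 k) => ? ? /=; rewrite mul0r subr0.
- apply/matrixP=> i j; rewrite !mxE.
  have := congr1 (@complex.Im R) (hi i); rewrite ImD.
  case: (z) (v 0 i) => a b [c e] /=; rewrite [a * e + _]addrC => <-.
  by apply: eq_bigr => k _; rewrite !mxE; case: (v 0 k) => ? ? /=; rewrite mul0r addr0.
Qed.

Lemma size_eigenvalues n (A : 'M[R]_n) : size (eigenvalues A) = n.
Proof.
have := size_char_poly (map_mx (real_complex R) A).
by rewrite char_poly_eigenvalues size_prod_XsubC => -[].
Qed.

(** For an eigenvector p + iq, the equality of <Ap, q> and <p, Aq> forces the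
    eigenvalue to be real; then p or q is a real eigenvector. *)
Lemma symmetric_unit_eigenvector n (A : 'M[R]_n) : (0 < n)%N -> A^T = A ->
  exists (v : 'cV[R]_n) (a : R), '[v, v] = 1 /\ A *m v = a *: v.
Proof.
move=> n0 sA; have : nth 0 (eigenvalues A) 0 \in eigenvalues A.
  by rewrite mem_nth ?size_eigenvalues.
move: (nth _ _ _) => z /complex_eigenvector[p [q [pq Ap Aq]]].
have : '[A *m p, q] = '[p, A *m q] by rewrite dot_trmx sA.
rewrite Ap Aq !(dotE ip1) => h.
have Im0 : complex.Im z = 0.
  have /eqP : complex.Im z * ('[p, p] + '[q, q]) = 0 by rewrite mulrDr; lra.
  by rewrite mulf_eq0 [_ + _ == 0]gt_eqF // orbF => /eqP.
move: Ap Aq; rewrite Im0 !scale0r subr0 add0r => Ap Aq.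
have [w w0 Aw] : exists2 w : 'cV[R]_n, w != 0 & A *m w = complex.Re z *: w.
  have [p0|] := eqVneq p 0; last by exists p.
  exists q => //; move: pq; rewrite p0 (dot0l ip1) add0r.
  by apply: contraTneq => ->; rewrite (dot0l ip1) ltxx.
have nw : 'N(w) != 0 by rewrite (enorm_eq0 ip1).
exists ('N(w)^-1 *: w), (complex.Re z); split.
  rewrite !(dotE ip1) -(enorm_sq ip1) expr2.
  by rewrite mulKf // mulVf.
by rewrite -scalemxAr Aw !scalerA mulrC.
Qed.

(** H is the reflection in the hyperplane orthogonal to v - e_0. *)
Lemma householder n (v : 'cV[R]_n.+1) : '[v, v] = 1 ->
  exists H : 'M[R]_n.+1, [/\ H^T = H, H *m H = 1%:M & H *m delta_mx 0 0 = v].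
Proof.
move=> vv; pose e : 'cV[R]_n.+1 := delta_mx 0 0.
have ee : '[e, e] = 1.
  by rewrite standard_dotE trmx_delta mul_delta_mx mxE !eqxx.
have [->|z0] := eqVneq v e.
  by exists 1%:M; rewrite trmx1 !mul1mx.
pose z := v - e; have zz : '[z, z] != 0.
  by rewrite gt_eqF // (proj2 ip1) // subr_eq0.
have zT x : z *m (z^T *m x) = '[z, x] *: z.
  by rewrite standard_dotE {1}[z^T *m x]mx11_scalar mul_mx_scalar.
exists (1%:M - (2 / '[z, z]) *: (z *m z^T)); split.
- by rewrite linearB linearZ /= trmx1 trmx_mul trmxK.
- have ZZ : z *m z^T *m (z *m z^T) = '[z, z] *: (z *m z^T).
    by rewrite mulmxA -[z *m _ *m z]mulmxA zT -scalemxAl.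
  rewrite mulmxBl mul1mx mulmxBr mulmx1 -scalemxAl -scalemxAr ZZ !scalerA -mulrA divfK //.
  by apply/matrixP => i j; rewrite !mxE; ring.
- rewrite mulmxBl mul1mx -scalemxAl -mulmxA -/e zT scalerA.
  have h : '[z, z] = - 2 * '[z, e].
    rewrite /z !(dotE ip1) vv ee (dotC ip1 e v); ring.
  have -> : 2 / '[z, z] * '[z, e] = -1.
    by apply: (mulIf zz); rewrite mulrAC divfK // h; ring.
  by rewrite scaleN1r opprK /z addrC subrK.
Qed.

(** A reflection moves a unit eigenvector to e_0; by symmetry the conjugated matrix is
    then block diagonal, with a smaller symmetric block. *)
Theorem spectral n (A : 'M[R]_n) : A^T = A ->
  exists (P : 'M[R]_n) (D : 'rV[R]_n),
    P *m P^T = 1%:M /\ A = P^T *m diag_mx D *m P.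
Proof.
elim: n A => [|n IH] A sA.
  by exists 1%:M, 0; split; [rewrite trmx1 mul1mx | apply/matrixP=> -[]].
have [v [a [vv Av]]] := symmetric_unit_eigenvector (ltn0Sn n) sA.
have [H [sH HH He]] := householder vv.
have [o ho] : exists o : 'I_(1 + n), o = lshift n 0 /\ H *m delta_mx o 0 = v.
  by exists (lshift n 0); rewrite (lshift0 n 0).
pose e : 'cV[R]_(1 + n) := delta_mx o 0; have {}He : H *m e = v by case: ho.
pose B : 'M[R]_(1 + n) := H *m A *m H.
have Be : B *m e = a *: e.
  by rewrite /B -!mulmxA He Av -scalemxAr -He mulmxA HH mul1mx.
have sB : B^T = B by rewrite /B !trmx_mul sH sA mulmxA.
have hA : A = H *m (B *m H).
  by rewrite /B -!mulmxA HH mulmx1 mulmxA HH mul1mx.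
clearbody B.
have B0 i : B i (lshift n 0) = a *+ (i == lshift n 0).
  have /matrixP/(_ i 0) := Be; rewrite /e -colE !mxE (proj1 ho) => ->.
  by rewrite eqxx andbT mulr_natr.
have [P' [D' [PP' hB']]] := IH (drsubmx B) (etrans (trmx_drsub B) (congr1 _ sB)).
have hB : B = block_mx a%:M 0 0 (drsubmx B).
  rewrite -[LHS]submxK; congr block_mx; apply/matrixP => i j.
  - by rewrite !mxE !ord1 B0 eqxx.
  - rewrite [in LHS]mxE -[in LHS]sB !mxE ord1 B0.
    by rewrite -val_eqE.
  - by rewrite !mxE ord1 B0 -val_eqE.
pose P : 'M[R]_(1 + n) := block_mx 1%:M 0 0 P'.
have PP : P *m P^T = 1%:M.
  rewrite /P tr_block_mx mulmx_block !trmx0 trmx1 !mul0mx !mulmx0 !mul1mx.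
  by rewrite !(add0r, addr0) PP' -scalar_mx_block.
pose D : 'rV[R]_(1 + n) := row_mx (const_mx a : 'rV_1) D'.
have PDP : P^T *m diag_mx D *m P = B.
  rewrite hB hB' /P diag_mx_row tr_block_mx !mulmx_block !trmx0 trmx1.
  rewrite !(mul0mx, mulmx0, mul1mx, mulmx1, add0r, addr0).
  congr block_mx; apply/matrixP=> i j; rewrite !ord1 !mxE eqxx //.
exists (P *m H), D; split.
  by rewrite trmx_mul sH -mulmxA (mulmxA H) HH mul1mx.
rewrite trmx_mul sH {1}hA -PDP.
by rewrite !mulmxA.
Qed.

End Eigenvalues.

Section SingularVectors.
Variables (R : realType).

(** The columns of the orthogonal matrix in [spectral], and what they say about the
    list of complex eigenvalues. *)
Lemma spectral_basis n (A : 'M[R]_n) : A^T = A ->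
  exists (f : 'I_n -> 'cV[R]_n) (D : 'I_n -> R),
  [/\ forall i, A *m f i = D i *: f i,
      forall i j, '[f i, f j] = (i == j)%:R,
      forall x, '[x, x] = \sum_i '[f i, x] ^+ 2,
      forall x, '[x, A *m x] = \sum_i D i * '[f i, x] ^+ 2 &
      perm_eq (eigenvalues A) [seq real_complex R (D i) | i <- enum 'I_n]].
Proof.
move=> /spectral[P [D [PP ->]]]; have PP' := mulmx1C PP.
pose f i := P^T *m delta_mx i 0 : 'cV[R]_n.
have fE i x : '[f i, x] = (P *m x) i 0.
  by rewrite /f dot_trmx trmxK standard_dotE trmx_delta -rowE mxE.
exists f, (fun i => D 0 i); split.
- move=> i; rewrite /f -!mulmxA [P *m (_ *m _)]mulmxA PP mul1mx scalemxAr.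
  congr (_ *m _); apply/matrixP => k l; rewrite -colE !mxE ord1 eqxx andbT.
  by have [->|] := eqVneq k i; rewrite ?mulr1n ?mulr1 ?mulr0n ?mulr0.
- move=> i j; rewrite fE /f mulmxA PP mul1mx !mxE eqxx andbT //.
- move=> x; have {1}-> : x = P^T *m (P *m x) by rewrite mulmxA PP' mul1mx.
  rewrite dot_trmx trmxK standard_sum.
  by apply: eq_bigr => i _; rewrite fE.
- move=> x; rewrite -!mulmxA dotC; last exact: ip1.
  rewrite dot_trmx trmxK standard_dotE mxE.
  by apply: eq_bigr => i _; rewrite fE mul_diag_mx !mxE expr2 mulrA.
apply: eigenvalues_perm; rewrite big_map big_enum /= -map_char_poly.
have -> : char_poly (P^T *m diag_mx D *m P) = char_poly (diag_mx D).
  rewrite /char_poly /char_poly_mx.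
  have -> : 'X%:M - map_mx polyC (P^T *m diag_mx D *m P) =
     map_mx polyC P^T *m ('X%:M - map_mx polyC (diag_mx D)) *m map_mx polyC P.
    rewrite mulmxBr mulmxBl mul_mx_scalar -scalemxAl -!map_mxM PP'.
    by rewrite map_mx1 scalemx1.
  rewrite !det_mulmx mulrAC -det_mulmx -map_mxM PP' map_mx1 det1 mul1r //.
rewrite char_poly_trig ?diag_mx_is_trig // rmorph_prod /=.
by apply: eq_bigr => i _; rewrite map_polyXsubC /= mxE eqxx mulr1n.
Qed.

Lemma sum_sq_le n (F G : 'I_n -> R) c : (forall i, F i != 0 -> G i <= c) ->
  \sum_i G i * F i ^+ 2 <= c * \sum_i F i ^+ 2.
Proof.
move=> h; rewrite mulr_sumr; apply: ler_sum => i _.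
have [->|] := eqVneq (F i) 0; first by rewrite expr0n !mulr0.
by move=> /h ?; rewrite ler_wpM2r ?sqr_ge0.
Qed.

(** In an eigenbasis of Q both norms are weighted sums of squares, with positive
    weights. *)
Lemma enorm_equiv n (Q : 'M[R]_n) : inner_product_matrix Q ->
  exists C : R, [/\ 1 <= C, forall x, enorm Q x <= C * 'N(x) &
    forall x, 'N(x) <= C * enorm Q x].
Proof.
move=> hQ; have [f [D [hf ff fx Dx _]]] := spectral_basis (proj1 hQ).
have dQ x : dot Q x x = \sum_i D i * '[f i, x] ^+ 2.
  by rewrite -Dx standard_dotE mulmxA.
have D0 i : 0 < D i.
  have fi : '[f i, f i] = 1 by rewrite ff eqxx.
  have : 0 < dot Q (f i) (f i).
    apply: (proj2 hQ); apply/eqP => h; move: fi; rewrite h dot0r.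
    by move/eqP; rewrite eq_sym oner_eq0.
  by rewrite /dot -mulmxA hf -scalemxAr mxE -standard_dotE fi mulr1.
pose c := 1 + \sum_i D i + \sum_i (D i)^-1.
have s1 : 0 <= \sum_i D i by apply: sumr_ge0 => i _; exact: ltW.
have s2 : 0 <= \sum_i (D i)^-1 by apply: sumr_ge0 => i _; rewrite invr_ge0 ltW.
have c1 : 1 <= c by rewrite /c; lra.
have c0 : 0 <= c by lra.
have D1 i : D i <= c.
  rewrite /c (bigD1 i) //= -!addrA.
  have : 0 <= \sum_(j | j != i) D j by apply: sumr_ge0 => j _; exact: ltW.
  by lra.
have D2 i : (D i)^-1 <= c.
  rewrite /c [X in _ + X](bigD1 i) //=.
  have : 0 <= \sum_(j | j != i) (D j)^-1.
    by apply: sumr_ge0 => j _; rewrite invr_ge0 ltW.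
  by lra.
have sqE (a b : R) : 0 <= a -> 0 <= b -> a ^+ 2 <= c * b ^+ 2 -> a <= c * b.
  move=> a0 b0 h; rewrite -(@ler_pXn2r _ 2) ?nnegrE ?mulr_ge0 //.
  apply: le_trans h _; rewrite exprMn ler_wpM2r ?sqr_ge0 //.
  by rewrite expr2 ler_peMl.
exists c; split => // x; apply: sqE; rewrite ?enorm_ge0 //.
  rewrite (enorm_sq hQ) (enorm_sq ip1) dQ fx; exact: sum_sq_le.
rewrite (enorm_sq hQ) (enorm_sq ip1) dQ fx mulr_sumr.
apply: ler_sum => i _; rewrite mulrA ler_peMl ?sqr_ge0 //.
by rewrite -ler_pdivrMr // mul1r.
Qed.

(** e1 and e2 are right singular vectors for the two largest singular values. The sorted
    list of singular values is a permutation of the square roots of the eigenvalues D of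
    an eigenbasis of g^T g, which gives indices i1 and i2 carrying the first two. *)
Lemma singular_vectors d (g : 'M[R]_d) : (2 <= d)%N ->
  exists e1 e2 : 'cV[R]_d,
  let a1 := singular_value 1 g in let a2 := singular_value 2 g in
  [/\ [/\ '[e1, e1] = 1, '[e2, e2] = 1 & '[e1, e2] = 0],
      [/\ 0 <= a1, 0 <= a2 & a2 <= a1],
      g^T *m (g *m e1) = a1 ^+ 2 *: e1, g^T *m (g *m e2) = a2 ^+ 2 *: e2 &
      (forall x, 'N(g *m x) <= a1 * 'N(x)) /\
      (forall x, '[e1, x] = 0 -> 'N(g *m x) <= a2 * 'N(x))].
Proof.
move=> d2; have sA : (g^T *m g)^T = g^T *m g by rewrite trmx_mul trmxK.
have [f [D [hf ff fx Dx hp]]] := spectral_basis sA.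
have Dg x : '[g *m x, g *m x] = \sum_i D i * '[f i, x] ^+ 2.
  by rewrite dot_trmx mulmxA Dx.
have D0 i : 0 <= D i.
  have := dot_ge0 ip1 (g *m f i).
  by rewrite dot_trmx mulmxA hf dotZr ff eqxx mulr1.
pose s := singular_values g.
have ps : perm_eq s [tuple Num.sqrt (D i) | i < d].
  rewrite /s /singular_values perm_sort.
  apply: perm_trans (perm_map _ hp) _; rewrite -map_comp.
  by apply/seq.permP => p; congr (count _ _); apply: eq_map.
have /tuple_permP[p sE] := ps.
have sn (i : 'I_d) : nth 0 s i = Num.sqrt (D (p i)).
  by rewrite sE -tnth_nth !tnth_mktuple.
have ss : sorted (fun x y : R => y <= x) s.
  by apply: sort_sorted => x y; exact: le_total.
have szs : size s = d by rewrite sE size_tuple.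
have mono (i j : 'I_d) : (i <= j)%N -> D (p j) <= D (p i).
  move=> ij; rewrite -ler_sqrt ?D0 // -!sn.
  apply: (sorted_leq_nth _ _ 0 ss) => //; rewrite ?inE ?szs //.
  by move=> x y z /= h1 h2; exact: le_trans h2 h1.
pose i1 := Ordinal (ltnW d2); pose i2 := Ordinal d2.
have a1E : singular_value 1 g = Num.sqrt (D (p i1)) by rewrite -sn.
have a2E : singular_value 2 g = Num.sqrt (D (p i2)) by rewrite -sn.
exists (f (p i1)), (f (p i2)) => /=; rewrite a1E a2E.
have pE i : exists j, i = p j by exists ((p^-1)%g i); rewrite permKV.
have le1 i : D i <= D (p i1) by have [j ->] := pE i; exact: mono.
have le2 i : i != p i1 -> D i <= D (p i2).
  have [j ->] := pE i; rewrite (inj_eq perm_inj) => ne.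
  by apply: mono; rewrite /= lt0n; apply: contra ne => /eqP h; apply/eqP/val_inj.
have sqle (x : 'cV[R]_d) i : (forall k, '[f k, x] != 0 -> D k <= D i) ->
    'N(g *m x) <= Num.sqrt (D i) * 'N(x).
  move=> h; rewrite -(@ler_pXn2r _ 2) ?nnegrE ?mulr_ge0 ?enorm_ge0 ?sqrtr_ge0 //.
  rewrite exprMn !(enorm_sq ip1) Dg sqr_sqrtr // fx.
  by apply: sum_sq_le => k /h.
split.
- by rewrite !ff !eqxx (inj_eq perm_inj).
- by rewrite !sqrtr_ge0 ler_sqrt ?D0 // mono.
- by rewrite mulmxA hf sqr_sqrtr.
- by rewrite mulmxA hf sqr_sqrtr.
split=> x => [|h]; apply: sqle => k // hk.
by apply: le2; apply: contraNneq hk => ->; rewrite h.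
Qed.

End SingularVectors.

(** * Words in a relatively compact set of matrices *)

Section Bilipschitz.
Variables (R : realType) (d : nat).
Implicit Types (s g : 'M[R]_d) (x : 'cV[R]_d) (K : R) (S : set 'M[R]_d).

Definition bilipschitz K g : Prop :=
  forall x, 'N(g *m x) <= K * 'N(x) /\ 'N(x) <= K * 'N(g *m x).

Lemma coord_le_enorm x i : `|x i 0| <= 'N(x).
Proof.
rewrite -(@ler_pXn2r _ 2) ?nnegrE ?enorm_ge0 // (enorm_sq ip1) standard_sum.
rewrite real_normK ?num_real // (bigD1 i) //= lerDl.
by apply: sumr_ge0 => j _; exact: sqr_ge0.
Qed.

Lemma enorm_le_sum x : 'N(x) <= \sum_i `|x i 0|.
Proof.
have s0 : 0 <= \sum_i `|x i 0| by apply: sumr_ge0.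
rewrite -(@ler_pXn2r _ 2) ?nnegrE ?enorm_ge0 // (enorm_sq ip1) standard_sum.
rewrite expr2 mulr_suml; apply: ler_sum => i _.
rewrite -real_normK ?num_real // expr2 ler_wpM2l // (bigD1 i) //= lerDl.
by apply: sumr_ge0.
Qed.

Lemma enorm_mulmx_le (B : R) g x : (forall i j, `|g i j| <= B) ->
  'N(g *m x) <= B * d%:R ^+ 2 * 'N(x).
Proof.
move=> hB; apply: le_trans (enorm_le_sum _) _.
apply: le_trans (_ : \sum_(i < d) \sum_(j < d) (B * 'N(x)) <= _).
  apply: ler_sum => i _; rewrite mxE; apply: le_trans (ler_norm_sum _ _ _) _.
  by apply: ler_sum => j _; rewrite normrM ler_pM // coord_le_enorm.
rewrite !sumr_const !card_ord -2!mulr_natr.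
by rewrite le_eqVlt; apply/orP; left; apply/eqP; ring.
Qed.

(** Stated for a matrix of functions so as to cover cofactors as well as determinants. *)
Lemma det_continuous (T : topologicalType) n (F : 'I_n -> 'I_n -> T -> R) :
  (forall i j, continuous (F i j)) ->
  continuous (fun t => \det (\matrix_(i, j) F i j t)).
Proof.
move=> cF; rewrite (_ : (fun t => _) = fun t : T => \sum_(s : 'S_n)
    ((-1) ^+ s * \prod_i F i (s i) t)); last first.
  apply/funext => t; rewrite /determinant; apply: eq_bigr => s _.
  by congr (_ * _); apply: eq_bigr => i _; rewrite mxE.
apply: (@continuous_big R _ +%R 0 xpredT).
  exact: (@pseudometric_normed_Zmodule.add_continuous R R^o).
move=> s _ t; apply: cvgM; first exact: cvg_cst.
move: t; apply: (@continuous_big R _ *%R 1 xpredT).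
  exact: mul_continuous.
by move=> i _; exact: cF.
Qed.

Lemma compact_entry_bound (C : set 'M[R]_d) (f : 'M[R]_d -> 'I_d -> 'I_d -> R) :
  compact C -> (forall s i j, C s -> {for s, continuous (fun s => f s i j)}) ->
  exists2 B : R, 0 <= B & forall s i j, C s -> `|f s i j| <= B.
Proof.
move=> cC hf.
have /choice[B hB] : forall p : 'I_d * 'I_d, exists B : R,
    0 <= B /\ forall s, C s -> `|f s p.1 p.2| <= B.
  case=> i j /=.
  have /(@compact_bounded R R^o)[M [_ hM]] : compact ((fun s => f s i j) @` C).
    apply: continuous_compact cC; apply: continuous_in_subspaceT => s.
    by rewrite inE => Cs; exact: hf.
  exists (`|M| + 1); split; first by rewrite addr_ge0.
  move=> s Cs; apply: (hM (`|M| + 1)).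
    by rewrite (le_lt_trans (ler_norm M)) // ltrDl.
  by exists s.
exists (\sum_p B p); first by apply: sumr_ge0 => p _; case: (hB p).
move=> s i j Cs; have [_ /(_ s Cs) h] := hB (i, j).
apply: (le_trans h); rewrite (bigD1 (i, j)) //= lerDl.
by apply: sumr_ge0 => p _; case: (hB p).
Qed.

(** On a compact subset of GL the entries of s are bounded, and so are those of the
    inverse, by Cramer's formula, because the determinant does not vanish there. *)
Lemma relatively_compact_bilipschitz S : relatively_compact_in_GL S ->
  exists2 K : R, 1 <= K & forall s, S s -> bilipschitz K s.
Proof.
case=> SGL cC; set C := closure S `&` GL in cC.
have SC s : S s -> C s by move=> Ss; split; [exact: subset_closure | exact: SGL].
have [B B0 hB] := compact_entry_bound cC (f := fun s i j => s i j)
  (fun s i j _ => @coord_continuous R d d i j s).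
have [B' B'0 hB'] : exists2 B : R, 0 <= B &
    forall s i j, C s -> `|invmx s i j| <= B.
  have [|B' B'0 hB'] := compact_entry_bound cC
     (f := fun s i j => (\det s)^-1 * cofactor s j i).
    move=> s i j [_]; rewrite /GL /= unitmxE unitfE => ds.
    have cdet n (f h : 'I_n -> 'I_d) :
        continuous (fun t : 'M[R]_d => \det (mxsub f h t)).
      rewrite (_ : (fun t => _) =
        fun t : 'M[R]_d => \det (\matrix_(k, l) t (f k) (h l))).
        by apply: det_continuous => k l; exact: coord_continuous.
      by apply/funext => t; congr (\det _); apply/matrixP => k l; rewrite !mxE.
    apply: (@cvgM R _ (nbhs s) _ (fun t : 'M[R]_d => (\det t)^-1)).
      apply: (@cvgV R _ (nbhs s) _ (fun t : 'M[R]_d => \det t)) => //.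
      have := @cdet d id id s; rewrite (_ : (fun t => _) = fun t : 'M[R]_d => \det t) //.
      by apply/funext => t; congr (\det _); apply/matrixP => k l; rewrite mxE.
    rewrite /cofactor; apply: cvgM; first exact: cvg_cst.
    have := @cdet d.-1 (lift j) (lift i) s.
    rewrite (_ : (fun t => _) = fun t : 'M[R]_d => \det (row' j (col' i t))) //.
    by apply/funext => t; congr (\det _); apply/matrixP => k l; rewrite !mxE.
  exists B' => // s i j Cs; have [_ us] := Cs.
  rewrite /invmx us !mxE; exact: hB'.
pose K := 1 + B * d%:R ^+ 2 + B' * d%:R ^+ 2.
have p1 : 0 <= B * d%:R ^+ 2 by rewrite mulr_ge0 ?exprn_ge0.
have p2 : 0 <= B' * d%:R ^+ 2 by rewrite mulr_ge0 ?exprn_ge0.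
exists K; first by rewrite /K; lra.
move=> s /SC Cs x; split.
  apply: le_trans (enorm_mulmx_le _ (fun i j => hB s i j Cs)) _.
  by rewrite ler_wpM2r ?enorm_ge0 // /K; lra.
have us : s \in unitmx by case: Cs.
rewrite -{1}[x](mulKmx us).
apply: le_trans (enorm_mulmx_le _ (fun i j => hB' s i j Cs)) _.
by rewrite ler_wpM2r ?enorm_ge0 // /K; lra.
Qed.

Lemma bilipschitz_tr K g : g \in unitmx -> bilipschitz K g -> bilipschitz K g^T.
Proof.
move=> ug hg x; split.
  have [->|n0] := eqVneq (g^T *m x) 0.
    rewrite (enorm0 ip1); have [h _] := hg x.
    have [->|x0] := eqVneq x 0; first by rewrite (enorm0 ip1) mulr0.
    have := le_trans (enorm_ge0 _ _) h.
    by [].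
  have y0 : 0 < 'N(g^T *m x) by rewrite (enorm_gt0 ip1).
  rewrite -(ler_pM2l y0) -expr2 (enorm_sq ip1) dot_trmx trmxK.
  apply: le_trans (ler_norm _) _.
  apply: le_trans (cauchy_schwarz ip1 _ _) _.
  have [h _] := hg (g^T *m x).
  apply: le_trans (ler_wpM2l (enorm_ge0 1%:M x) h) _.
  by rewrite le_eqVlt; apply/orP; left; apply/eqP; ring.
have [->|x0] := eqVneq x 0.
  by rewrite mulmx0 (enorm0 ip1) mulr0.
have nx : 0 < 'N(x) by rewrite (enorm_gt0 ip1).
rewrite -(ler_pM2l nx) -expr2 (enorm_sq ip1).
have [z xz] : exists z, x = g *m z by exists (invmx g *m x); rewrite mulKVmx.
have -> : '[x, x] = '[z, g^T *m x] by rewrite {1}xz dot_trmx.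
apply: le_trans (ler_norm _) _.
apply: le_trans (cauchy_schwarz ip1 _ _) _.
have [_ h] := hg z; rewrite -xz in h.
apply: le_trans (ler_wpM2r (enorm_ge0 1%:M (g^T *m x)) h) _.
by rewrite le_eqVlt; apply/orP; left; apply/eqP; ring.
Qed.

Lemma bilipschitzM K L g h : 0 <= K -> 0 <= L -> bilipschitz K g ->
  bilipschitz L h -> bilipschitz (K * L) (g *m h).
Proof.
move=> K0 L0 hg hh x; rewrite -mulmxA.
have [g1 g2] := hg (h *m x); have [h1 h2] := hh x; split.
  by apply: le_trans g1 _; rewrite -mulrA ler_wpM2l.
by apply: le_trans h2 _; rewrite [K * L]mulrC -mulrA ler_wpM2l.
Qed.

End Bilipschitz.

(** The monoid structure lets the product of a word be cut at any letter. *)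
HB.instance Definition _ (R : realType) (d : nat) :=
  Monoid.isLaw.Build 'M[R]_d 1%:M (@mulmx R d d d)
    (@mulmxA R d d d d) (@mul1mx R d d) (@mulmx1 R d d).

Section Words.
Variables (R : realType) (d : nat).
Implicit Types (s g a b : 'M[R]_d) (S : set 'M[R]_d).

Lemma set_power0 S g : set_power S 0 g -> g = 1%:M.
Proof. by case=> h [_ ->]; rewrite big_ord0. Qed.

Lemma set_power1 S g : set_power S 1 g <-> S g.
Proof.
split=> [[h [Sh ->]]|Sg]; first by rewrite big_ord_recl big_ord0 mulmx1; exact: Sh.
by exists (fun _ => g); split=> //; rewrite big_ord_recl big_ord0 mulmx1.
Qed.

Lemma set_powerM S m n a b : set_power S m a -> set_power S n b ->
  set_power S (m + n) (a *m b).
Proof.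
case=> f [Sf ->] [h [Sh ->]].
exists (fun i => match split i with inl j => f j | inr j => h j end); split.
  by move=> i; case: split.
rewrite big_split_ord /=; congr (_ *m _); apply: eq_bigr => i _.
  by rewrite (unsplitK (inl i)).
by rewrite (unsplitK (inr i)).
Qed.

Lemma set_power_split S m n g : set_power S (m + n) g ->
  exists a b, [/\ set_power S m a, set_power S n b & g = a *m b].
Proof.
case=> f [Sf ->]; rewrite big_split_ord /=.
by do 2 eexists; split; last reflexivity; eexists; split=> [i|]; try reflexivity.
Qed.

Lemma set_powerS S n g : set_power S n.+1 g ->
  exists s b, [/\ S s, set_power S n b & g = s *m b].
Proof.
rewrite -add1n => /set_power_split[s [b [/set_power1 Ss hb ->]]].
by exists s, b.
Qed.

Lemma set_power_unit S n g : S `<=` GL -> set_power S n g -> g \in unitmx.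
Proof.
move=> SGL; elim: n g => [|n IH] g.
  by move/set_power0 => ->; rewrite unitmx1.
by case/set_powerS => s [b [/SGL ss /IH hb ->]]; rewrite unitmx_mul ss.
Qed.

Lemma set_power_bilipschitz S K n g : 1 <= K ->
  (forall s, S s -> bilipschitz K s) -> set_power S n g -> bilipschitz (K ^+ n) g.
Proof.
move=> K1 hS; have K0 : 0 <= K by lra.
elim: n g => [|n IH] g.
  by move/set_power0 => -> x; rewrite mul1mx mul1r.
case/set_powerS => s [b [/hS hs /IH hb ->]]; rewrite exprS.
by apply: bilipschitzM => //; rewrite exprn_ge0.
Qed.

Definition transposes S : set 'M[R]_d := [set g | S g^T].

Lemma transposesK S : transposes (transposes S) = S.
Proof. by apply/funext => g; rewrite /transposes /= trmxK. Qed.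

Lemma set_power_tr S n g : set_power S n g -> set_power (transposes S) n g^T.
Proof.
elim: n g => [|n IH] g.
  by case=> h [_ ->]; rewrite big_ord0 trmx1; exists (fun=> 0); split=> [[]|]; rewrite ?big_ord0.
case/set_powerS => s [b [Ss /IH hb ->]].
by rewrite trmx_mul -addn1; apply: set_powerM => //; apply/set_power1; rewrite /transposes /= trmxK.
Qed.

End Words.

(** * Transversality in a dominated semigroup *)

Section NearRankOne.
Variables (R : realType) (d : nat).
Implicit Types (g : 'M[R]_d) (x y u w : 'cV[R]_d) (a eta : R).

(** g is a u w^T plus a map that kills w, takes values orthogonal to u and has norm at
    most eta a. For the singular value decomposition, a is the largest singular value
    and eta the ratio of the second one to it. *)
Definition near_rank_one g a eta u w : Prop :=
  [/\ 0 < a /\ '[u, u] = 1 /\ '[w, w] = 1, g *m w = a *: u, g^T *m u = a *: w,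
      forall x, 'N(g *m x) <= a * 'N(x) &
      forall x, '[w, x] = 0 -> 'N(g *m x) <= eta * a * 'N(x)].

Lemma enorm_unit x : '[x, x] = 1 -> 'N(x) = 1.
Proof. by rewrite /enorm => ->; rewrite sqrtr1. Qed.

Lemma dot_unit_le x y : '[x, x] = 1 -> `|'[x, y]| <= 'N(y).
Proof. by move=> /enorm_unit h; rewrite (le_trans (cauchy_schwarz ip1 _ _)) // h mul1r. Qed.

Lemma orthogonal_part w x : '[w, w] = 1 ->
  let y := x - '[w, x] *: w in
  [/\ '[w, y] = 0, '[x, y] = '[y, y] & 'N(y) <= 'N(x)].
Proof.
move=> ww y; have wy : '[w, y] = 0 by rewrite /y !(dotE ip1) ww mulr1 subrr.
have xy : '[x, y] = '[y, y].
  by rewrite {2}/y dotDl ?dotNl ?dotZl ?wy ?mulr0 ?subr0 //; exact: ip1.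
split=> //; have [->|y0] := eqVneq y 0; first by rewrite (enorm0 ip1) enorm_ge0.
rewrite -(@ler_pM2r _ 'N(y)) ?(enorm_gt0 ip1) // -expr2 (enorm_sq ip1) -xy.
exact: le_trans (ler_norm _) (cauchy_schwarz ip1 _ _).
Qed.

Section Facts.
Variables (g : 'M[R]_d) (a eta : R) (u w : 'cV[R]_d).
Hypothesis hg : near_rank_one g a eta u w.

Lemma near_rank_one_dot x : '[u, g *m x] = a * '[w, x].
Proof.
by case: hg => _ _ gu _ _; rewrite dotC ?dot_trmx ?gu ?dotZr ?(dotC ip1 x) //; exact: ip1.
Qed.

Lemma near_rank_one_ge x : a * `|'[w, x]| <= 'N(g *m x).
Proof.
have [[a0 [uu _]] _ _ _ _] := hg.
by rewrite -{1}(gtr0_norm a0) -normrM -near_rank_one_dot dot_unit_le.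
Qed.

Lemma near_rank_one_split x : 0 <= eta ->
  exists r, g *m x = (a * '[w, x]) *: u + r /\ 'N(r) <= eta * a * 'N(x).
Proof.
have [[a0 [uu ww]] gw _ _ h] := hg => eta0.
have [wy _ yx] := orthogonal_part x ww; set y := x - _ in wy yx.
exists (g *m y); split.
  by rewrite /y mulmxBr -scalemxAr gw scalerA [_ * a]mulrC addrC subrK.
apply: le_trans (h _ wy) _; apply: ler_wpM2l => //.
by rewrite mulr_ge0 // ltW.
Qed.

Lemma near_rank_one_le x : 0 <= eta ->
  'N(g *m x) <= a * (`|'[w, x]| + eta * 'N(x)).
Proof.
move=> /(near_rank_one_split x)[r [-> hr]]; have [[a0 [uu ww]] _ _ _ _] := hg.
apply: le_trans (enormD ip1 _ _) _; rewrite (enormZ ip1) (enorm_unit uu) mulr1.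
by rewrite normrM (gtr0_norm a0) mulrDr lerD2l mulrCA mulrA.
Qed.

Lemma near_rank_one_top : 'N(g *m w) = a.
Proof.
have [[a0 [uu _]] -> _ _ _] := hg.
by rewrite (enormZ ip1) (enorm_unit uu) mulr1 gtr0_norm.
Qed.

(** A vector y orthogonal to u has g^T y orthogonal to w, and
    |g^T y|^2 = <y, g g^T y> is bounded by |y| times the bound of g on w's orthogonal. *)
Lemma near_rank_one_tr : 0 <= eta -> near_rank_one g^T a eta w u.
Proof.
move=> eta0; have [[a0 [uu ww]] gw gu h1 h2] := hg.
split; rewrite ?trmxK // => y.
  have [->|z0] := eqVneq (g^T *m y) 0.
    by rewrite (enorm0 ip1) mulr_ge0 ?enorm_ge0 ?ltW.
  rewrite -(@ler_pM2l _ 'N(g^T *m y)) ?(enorm_gt0 ip1) // -expr2 (enorm_sq ip1).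
  rewrite dot_trmx trmxK; apply: le_trans (ler_norm _) _.
  apply: le_trans (cauchy_schwarz ip1 _ _) _.
  apply: le_trans (ler_wpM2l (enorm_ge0 _ _) (h1 _)) _.
  by rewrite le_eqVlt; apply/orP; left; apply/eqP; ring.
move=> uy; have [->|z0] := eqVneq (g^T *m y) 0.
  by rewrite (enorm0 ip1) mulr_ge0 ?enorm_ge0 // mulr_ge0 // ltW.
rewrite -(@ler_pM2l _ 'N(g^T *m y)) ?(enorm_gt0 ip1) // -expr2 (enorm_sq ip1).
rewrite dot_trmx trmxK; apply: le_trans (ler_norm _) _.
apply: le_trans (cauchy_schwarz ip1 _ _) _.
have wz : '[w, g^T *m y] = 0 by rewrite -dot_trmx gw (dotZl ip1) uy mulr0.
apply: le_trans (ler_wpM2l (enorm_ge0 _ _) (h2 _ wz)) _.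
by rewrite le_eqVlt; apply/orP; left; apply/eqP; ring.
Qed.

End Facts.

Lemma singular_frame : (2 <= d)%N -> exists u w : 'M[R]_d -> 'cV[R]_d,
  forall g, g \in unitmx ->
    near_rank_one g (singular_value 1 g)
      (singular_value 2 g / singular_value 1 g) (u g) (w g).
Proof.
move=> d2.
have h (g : 'M[R]_d) : exists uw : 'cV[R]_d * 'cV[R]_d, g \in unitmx ->
    near_rank_one g (singular_value 1 g)
      (singular_value 2 g / singular_value 1 g) uw.1 uw.2.
  have [e1 [e2 /= [[e11 _ _] [a1 a2 _] ge1 _ [h1 h2]]]] := singular_vectors g d2.
  exists ((singular_value 1 g)^-1 *: (g *m e1), e1) => ug /=.
  have a0 : 0 < singular_value 1 g.
    have := h1 e1; rewrite (enorm_unit e11) mulr1; apply: lt_le_trans.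
    rewrite (enorm_gt0 ip1); apply: contraTneq isT => h.
    have : e1 = 0 by rewrite -[e1](mulKmx ug) h mulmx0.
    by move=> e0; move: e11; rewrite e0 dot0r => /eqP; rewrite eq_sym oner_eq0.
  split=> //.
  - split=> //; split=> //; rewrite !(dotE ip1) dot_trmx ge1 dotZr e11 mulr1.
    by rewrite expr2 mulKf ?gt_eqF // mulVf // gt_eqF.
  - by rewrite scalerA divff ?gt_eqF // scale1r.
  - by rewrite -scalemxAr ge1 scalerA expr2 mulKf ?gt_eqF.
  - by move=> x hx; rewrite divfK ?gt_eqF //; exact: h2.
have [f hf] := choice h.
by exists (fun g => (f g).1), (fun g => (f g).2) => g; exact: hf.
Qed.

End NearRankOne.

Section PowerDecay.
Variable R : realType.

Lemma expr_eventually_le (t c : R) : 0 <= t < 1 -> 0 < c ->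
  exists N, forall n, (N <= n)%N -> t ^+ n <= c.
Proof.
move=> /andP[t0 t1] c0.
have /cvgr0_norm_le/(_ _ c0)[N _ hN] : (fun n => t ^+ n) @ \oo --> (0 : R).
  by apply: cvg_expr; rewrite ger0_norm.
by exists N => n /hN /=; rewrite ger0_norm // exprn_ge0.
Qed.

End PowerDecay.

Section Frames.
Variables (R : realType) (d : nat).
Implicit Types (S : set 'M[R]_d) (a : 'M[R]_d -> R) (u w : 'M[R]_d -> 'cV[R]_d).

(** The singular data of long words. Here a, u and w are functions of the matrix, so that
    a word has the same singular vectors whichever way it is cut. *)
Definition dominated_frame S (K tau : R) N0 a u w : Prop :=
  [/\ 1 <= K, 0 < tau < 1, S `<=` GL, forall s, S s -> bilipschitz K s &
      forall n g, (N0 <= n)%N -> set_power S n g ->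
        near_rank_one g (a g) (tau ^+ n) (u g) (w g)].

Lemma dominated_frame_tr S K tau N0 a u w : dominated_frame S K tau N0 a u w ->
  dominated_frame (transposes S) K tau N0 (a \o trmx) (w \o trmx) (u \o trmx).
Proof.
case=> K1 tau01 SGL hS hd; have tau0 : 0 <= tau by lra.
split=> //.
- by move=> s /SGL; rewrite /GL /= unitmx_tr.
- move=> s Ss; rewrite -[s]trmxK; apply: bilipschitz_tr; last exact: hS.
  exact: SGL.
move=> n g Nn /set_power_tr; rewrite transposesK => /(hd _ _ Nn).
by move/near_rank_one_tr; rewrite trmxK /=; apply; rewrite exprn_ge0.
Qed.

(** Multiplying g on the left moves its top right singular vector by an amount that is
    exponentially small in the length n of g. Indeed, if x is orthogonal to w (s g), then
    s g x is smaller than |g| |x| by a factor of order tau^n; so is g x, since s is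
    bilipschitz, and therefore x is nearly orthogonal to w g. *)
Lemma right_vector_step S K tau N0 a u w n g s z :
  dominated_frame S K tau N0 a u w -> (N0 <= n)%N -> set_power S n g -> S s ->
  `|'[z, w g]| <= `|'[z, w (s *m g)]| + K ^+ 2 * tau ^+ n * 'N(z).
Proof.
case=> K1 tau01 _ hS hd Nn gn Ss.
have K0 : 0 < K by lra.
have sgn : set_power S n.+1 (s *m g).
  by rewrite -add1n; apply: set_powerM => //; apply/set_power1.
have hg := hd _ _ Nn gn; have hsg := hd _ _ (leqW Nn) sgn.
have [[a0 [_ ww]] _ _ ha _] := hg; have [[_ [_ ww']] _ _ _ hb] := hsg.
have [wx xx _] := orthogonal_part (w g) ww'; set x := w g - _ in wx xx.
have t0 : 0 <= tau ^+ n by rewrite exprn_ge0; lra.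
have a'le : a (s *m g) <= K * a g.
  rewrite -(near_rank_one_top hsg) -mulmxA.
  apply: le_trans (proj1 (hS _ Ss _)) _; rewrite ler_pM2l //.
  by apply: le_trans (ha _) _; rewrite (enorm_unit ww') mulr1.
have gx : 'N(g *m x) <= K ^+ 2 * tau ^+ n * a g * 'N(x).
  apply: le_trans (proj2 (hS _ Ss _)) _; rewrite mulmxA.
  apply: le_trans (_ : K * (tau ^+ n * (K * a g) * 'N(x)) <= _); last first.
    by rewrite le_eqVlt; apply/orP; left; apply/eqP; ring.
  rewrite ler_pM2l //; apply: le_trans (hb _ wx) _.
  rewrite ler_wpM2r ?enorm_ge0 // ler_pM //.
  - by rewrite exprn_ge0; lra.
  - by rewrite -(near_rank_one_top hsg) enorm_ge0.
  - by rewrite exprS ler_piMl //; lra.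
have nx : 'N(x) <= K ^+ 2 * tau ^+ n.
  have [->|x0] := eqVneq x 0.
    by rewrite (enorm0 ip1) mulr_ge0 // exprn_ge0 // ltW.
  have nx0 : 0 < 'N(x) by rewrite (enorm_gt0 ip1).
  rewrite -(ler_pM2r nx0) -expr2 (enorm_sq ip1) -xx -(ler_pM2l a0).
  apply: le_trans (_ : a g * `|'[w g, x]| <= _).
    by rewrite ler_pM2l // ler_norm.
  apply: le_trans (near_rank_one_ge hg x) _; apply: le_trans gx _.
  by rewrite le_eqVlt; apply/orP; left; apply/eqP; ring.
have -> : w g = '[w (s *m g), w g] *: w (s *m g) + x by rewrite /x addrC subrK.
rewrite dotDr dotZr; apply: le_trans (ler_normD _ _) _; apply: lerD.
  rewrite normrM ler_piMl //; apply: le_trans (dot_unit_le _ ww') _.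
  by rewrite (enorm_unit ww).
apply: le_trans (cauchy_schwarz ip1 _ _) _.
by rewrite mulrC ler_wpM2r ?enorm_ge0.
Qed.

(** The errors of the successive letters form a geometric series. *)
Lemma right_vector_stable S K tau N0 a u w n m g h z :
  dominated_frame S K tau N0 a u w -> (N0 <= n)%N ->
  set_power S n g -> set_power S m h ->
  `|'[z, w g]| <= `|'[z, w (h *m g)]| + K ^+ 2 / (1 - tau) * tau ^+ n * 'N(z).
Proof.
move=> fr Nn gn; have [K1 tau01 _ _ _] := fr.
have t1 : 0 < 1 - tau by lra.
(* the partial sum of the series is what the induction preserves *)
suff H : set_power S m h -> `|'[z, w g]| <= `|'[z, w (h *m g)]| +
    K ^+ 2 / (1 - tau) * tau ^+ n * (1 - tau ^+ m) * 'N(z).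
  move/H => {}H; apply: le_trans H _; rewrite lerD2l ler_wpM2r ?enorm_ge0 //.
  rewrite ler_piMr //; last by rewrite gerBl exprn_ge0; lra.
  by rewrite mulr_ge0 ?exprn_ge0 ?divr_ge0 ?exprn_ge0 //; lra.
elim: m h => [|m IH] h.
  by move/set_power0 => ->; rewrite mul1mx expr0 subrr mulr0 mul0r addr0.
case/set_powerS => s [b [Ss bm ->]]; rewrite -mulmxA.
apply: le_trans (IH _ bm) _.
have Nmn : (N0 <= m + n)%N by rewrite (leq_trans Nn) // leq_addl.
have := right_vector_step z fr Nmn (set_powerM bm gn) Ss.
move=> h1; apply: le_trans (lerD h1 (lexx _)) _.
rewrite -addrA lerD2l -mulrDl ler_wpM2r ?enorm_ge0 //.
rewrite le_eqVlt; apply/orP; left; apply/eqP; rewrite exprD [tau ^+ m.+1]exprS.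
by field; rewrite gt_eqF.
Qed.

Lemma left_vector_stable S K tau N0 a u w n m g h z :
  dominated_frame S K tau N0 a u w -> (N0 <= n)%N ->
  set_power S n g -> set_power S m h ->
  `|'[z, u g]| <= `|'[z, u (g *m h)]| + K ^+ 2 / (1 - tau) * tau ^+ n * 'N(z).
Proof.
move=> /dominated_frame_tr fr Nn /set_power_tr gn /set_power_tr hm.
by have := right_vector_stable z fr Nn gn hm; rewrite /= trmxK -trmx_mul trmxK.
Qed.

End Frames.

Section Transversality.
Variables (R : realType) (d : nat) (S : set 'M[R]_d) (K tau : R) (N0 : nat).
Variables (a : 'M[R]_d -> R) (u w : 'M[R]_d -> 'cV[R]_d).
Hypothesis fr : dominated_frame S K tau N0 a u w.

Let K1 : 1 <= K. Proof. by case: fr. Qed.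
Let K0 : 0 < K. Proof. by have := K1; lra. Qed.
Let tau0 : 0 < tau. Proof. by case: fr => _ /andP[]. Qed.
Let tau1 : tau < 1. Proof. by case: fr => _ /andP[]. Qed.
Let powS s : S s -> bilipschitz K s. Proof. by case: fr => _ _ _ h _; exact: h. Qed.
Let frame n g : (N0 <= n)%N -> set_power S n g ->
  near_rank_one g (a g) (tau ^+ n) (u g) (w g).
Proof. by case: fr => _ _ _ _; apply. Qed.
Let taun n : 0 <= tau ^+ n. Proof. by rewrite exprn_ge0 // ltW. Qed.
Let a_gt0 n g : (N0 <= n)%N -> set_power S n g -> 0 < a g.
Proof. by move=> Nn gn; case: (frame Nn gn) => -[]. Qed.

(** It vanishes when G kills, to leading order, the image direction of A. *)
Local Notation beta G A := `|'[w G, u A]|.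

(** With [norm_product_ge], beta is the loss of norm in the product G A, up to an
    exponentially small error. *)
Lemma norm_product_le n m G A : (N0 <= n)%N -> (N0 <= m)%N ->
  set_power S n G -> set_power S m A ->
  a (G *m A) <= a G * a A * (beta G A + tau ^+ n + tau ^+ m).
Proof.
move=> Nn Nm Gn Am; have hG := frame Nn Gn; have hA := frame Nm Am.
have hGA := frame (leq_trans Nn (leq_addr m n)) (set_powerM Gn Am).
have [[aG [_ wwG]] _ _ hGle _] := hG; have [[aA [uuA wwA]] _ _ _ _] := hA.
have [[_ [_ ww]] _ _ _ _] := hGA.
rewrite -(near_rank_one_top hGA) -mulmxA; set x := w (G *m A) in ww *.
have nx := enorm_unit ww.
have [r [-> hr]] := near_rank_one_split hA x (taun m).
rewrite mulmxDr -scalemxAr; apply: le_trans (enormD ip1 _ _) _.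
have h1 : 'N((a A * '[w A, x]) *: (G *m u A)) <=
    a A * (a G * (beta G A + tau ^+ n)).
  rewrite (enormZ ip1) normrM (gtr0_norm aA) -mulrA ler_pM2l //.
  have := near_rank_one_le hG (u A) (taun n); rewrite (enorm_unit uuA) mulr1.
  apply: le_trans; rewrite ler_piMl ?enorm_ge0 //.
  by rewrite (le_trans (dot_unit_le _ wwA)) // nx.
have h2 : 'N(G *m r) <= a G * (tau ^+ m * a A).
  by apply: le_trans (hGle _) _; rewrite ler_pM2l //; rewrite nx mulr1 in hr.
apply: le_trans (lerD h1 h2) _.
by rewrite le_eqVlt; apply/orP; left; apply/eqP; ring.
Qed.

Lemma norm_product_ge n m G A : (N0 <= n)%N -> (N0 <= m)%N ->
  set_power S n G -> set_power S m A -> a G * a A * beta G A <= a (G *m A).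
Proof.
move=> Nn Nm Gn Am; have hG := frame Nn Gn; have hA := frame Nm Am.
have hGA := frame (leq_trans Nn (leq_addr m n)) (set_powerM Gn Am).
have [_ _ _ h _] := hGA; have [[aA [_ wwA]] Aw _ _ _] := hA.
have := h (w A); rewrite (enorm_unit wwA) mulr1; apply: le_trans.
rewrite -mulmxA Aw -scalemxAr (enormZ ip1) (gtr0_norm aA) [a G * _]mulrC -mulrA.
by rewrite ler_pM2l // (near_rank_one_ge hG).
Qed.

(** Moving one letter across a cut changes beta by a bounded factor only, because the
    product itself does not change and its norm determines beta. *)
Lemma beta_shift1 N n m G s A : (N0 <= N)%N -> (N <= n)%N -> (N <= m)%N ->
  set_power S n G -> S s -> set_power S m A ->
  beta G (s *m A) <= K ^+ 2 * (beta (G *m s) A + 2 * tau ^+ N).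
Proof.
move=> NN Nn Nm Gn Ss Am.
have Gs : set_power S n.+1 (G *m s) by rewrite -addn1; apply: set_powerM => //; apply/set_power1.
have sA : set_power S m.+1 (s *m A) by rewrite -add1n; apply: set_powerM => //; apply/set_power1.
have n0 := leq_trans NN Nn; have m0 := leq_trans NN Nm.
have aG := a_gt0 n0 Gn; have asA := a_gt0 (leqW m0) sA; have aA := a_gt0 m0 Am.
have h1 := norm_product_ge n0 (leqW m0) Gn sA.
have h2 := norm_product_le (leqW n0) m0 Gs Am.
have aGs : a (G *m s) <= K * a G.
  have hGs := frame (leqW n0) Gs; have [[_ [_ ww]] _ _ _ _] := hGs.
  have [_ _ _ h _] := frame n0 Gn.
  rewrite -(near_rank_one_top hGs) -mulmxA; apply: le_trans (h _) _.
  rewrite mulrC ler_pM2r //.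
  by apply: le_trans (proj1 (powS Ss _)) _; rewrite (enorm_unit ww) mulr1.
have aAs : a A <= K * a (s *m A).
  have hA := frame m0 Am; have [[_ [_ ww]] _ _ _ _] := hA.
  have [_ _ _ h _] := frame (leqW m0) sA.
  rewrite -(near_rank_one_top hA); apply: le_trans (proj2 (powS Ss _)) _.
  rewrite ler_pM2l // mulmxA; apply: le_trans (h _) _.
  by rewrite (enorm_unit ww) mulr1.
rewrite -(ler_pM2l (mulr_gt0 aG asA)); apply: le_trans h1 _.
rewrite mulmxA; apply: le_trans h2 _.
have tle k : (N <= k)%N -> tau ^+ k <= tau ^+ N.
  by move=> h; rewrite ler_wiXn2l // ltW.
apply: le_trans (_ : (K * a G) * (K * a (s *m A)) *
  (beta (G *m s) A + 2 * tau ^+ N) <= _); last first.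
  by rewrite le_eqVlt; apply/orP; left; apply/eqP; ring.
have p : 0 < a (G *m s) := a_gt0 (leqW n0) Gs.
apply: ler_pM.
- by rewrite mulr_ge0 // ltW.
- by rewrite !addr_ge0.
- by apply: ler_pM => //; exact: ltW.
by have := tle _ Nm; have := tle _ (leqW Nn); lra.
Qed.

Lemma beta_shift N n m q G P A : (N0 <= N)%N -> (N <= n)%N -> (N <= m)%N ->
  set_power S n G -> set_power S q P -> set_power S m A ->
  beta G (P *m A) <= (K ^+ 2) ^+ q * (beta (G *m P) A + (2 * q)%:R * tau ^+ N).
Proof.
move=> NN; elim: q n G P => [|q IH] n G P Nn Nm Gn.
  by move/set_power0 => -> _; rewrite mul1mx mulmx1 expr0 mul1r muln0 mul0r addr0.
case/set_powerS => s [b [Ss bq ->]] Am; rewrite -mulmxA.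
have bA := set_powerM bq Am.
apply: le_trans (beta_shift1 NN Nn (leq_trans Nm (leq_addl q m)) Gn Ss bA) _.
have Gs : set_power S n.+1 (G *m s) by rewrite -addn1; apply: set_powerM => //; apply/set_power1.
have h := IH _ _ _ (leqW Nn) Nm Gs bq Am.
rewrite [_ ^+ q.+1]exprS -mulrA ler_pM2l ?exprn_gt0 //.
have e : 1 <= (K ^+ 2) ^+ q by rewrite exprn_ege1 // exprn_ege1.
have tN := taun N.
have := ler_wpM2r tN e; rewrite mul1r => h'.
apply: le_trans (lerD h (lexx _)) _.
rewrite mulnS natrD mulmxA; move: h'.
by set c := _ ^+ q; set t := tau ^+ N; set y := `|_|; lra.
Qed.

(** The constant of [right_vector_stable] and [left_vector_stable]. *)
Definition drift : R := K ^+ 2 / (1 - tau).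

Let drift_ge0 : 0 <= drift.
Proof. by rewrite divr_ge0 ?exprn_ge0 ?subr_ge0 ?ltW. Qed.

(** If beta is tiny at all the cuts of a word B inside a longer word G B A, then the norm
    of B is superexponentially small. In the product of the two halves of B, each of
    length l, beta is of order tau^l: it differs from beta at the same cut of G B A by the
    drift of the singular vectors only. Hence each dyadic level multiplies the bound by
    a power of tau proportional to the length of B. *)
Lemma bad_word_norm N2 j n m G B A kappa :
  (0 < N2)%N -> (N0 <= N2)%N -> (3 + 2 * drift) * tau ^+ N2 <= 1 ->
  (N0 <= n)%N -> (N0 <= m)%N ->
  set_power S n G -> set_power S (3 * N2 * 2 ^ j) B -> set_power S m A ->
  kappa <= tau ^+ (3 * N2 * 2 ^ j) ->
  (forall p q B1 B2, (p + q = 3 * N2 * 2 ^ j)%N -> set_power S p B1 ->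
    set_power S q B2 -> B = B1 *m B2 -> beta (G *m B1) (B2 *m A) <= kappa) ->
  a B <= (K ^+ (3 * N2) * tau ^+ (N2 * j)) ^+ (2 ^ j).
Proof.
move=> N2_gt0 NN2 hC; elim: j n m G B A kappa => [|j IH] n m G B A kappa.
  move=> _ _ _ hB _ _ _; rewrite expn0 muln0 expr0 mulr1 expr1.
  rewrite expn0 muln1 in hB.
  have N3 : (N0 <= 3 * N2)%N by rewrite (leq_trans NN2) // leq_pmull.
  have h := frame N3 hB; have [[_ [_ ww]] _ _ _ _] := h.
  rewrite -(near_rank_one_top h).
  apply: le_trans (proj1 (set_power_bilipschitz K1 powS hB (w B))) _.
  by rewrite (enorm_unit ww) mulr1.
rewrite expnS mulnCA; set l := (3 * N2 * 2 ^ j)%N => Nn Nm Gn.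
rewrite mul2n -addnn => hB Am hk bad.
have Nl : (N2 <= l)%N.
  by rewrite /l mulnAC leq_pmull // muln_gt0 expn_gt0.
have Nl0 := leq_trans NN2 Nl.
have [B1 [B2 [hB1 hB2 eB]]] := set_power_split hB.
have kl : kappa <= tau ^+ l.
  apply: le_trans hk _; rewrite exprD ler_piMl // exprn_ile1 // ltW //.
have h1 : a B1 <= (K ^+ (3 * N2) * tau ^+ (N2 * j)) ^+ (2 ^ j).
  apply: (IH n (l + m)%N G B1 (B2 *m A) kappa) => //.
  - by rewrite (leq_trans Nm) // leq_addl.
  - exact: set_powerM.
  move=> p q D1 D2 pq hD1 hD2 eD; rewrite mulmxA.
  apply: (bad p (q + l)%N) => //; first by rewrite addnA pq.
    exact: set_powerM.
  by rewrite eB eD mulmxA.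
have h2 : a B2 <= (K ^+ (3 * N2) * tau ^+ (N2 * j)) ^+ (2 ^ j).
  apply: (IH (n + l)%N m (G *m B1) B2 A kappa) => //.
  - by rewrite (leq_trans Nn) // leq_addr.
  - exact: set_powerM.
  move=> p q D1 D2 pq hD1 hD2 eD; rewrite -mulmxA.
  apply: (bad (l + p)%N q) => //; first by rewrite -addnA pq.
    exact: set_powerM.
  by rewrite eB eD mulmxA.
have b12 : beta B1 B2 <= (1 + 2 * drift) * tau ^+ l.
  have uu : 'N(u B2) = 1 by have [[_ [/enorm_unit]]] := frame Nl0 hB2.
  have ww : 'N(w (G *m B1)) = 1.
    have k0 : (N0 <= n + l)%N by rewrite (leq_trans Nl0) // leq_addl.
    by have [[_ [_ /enorm_unit]]] := frame k0 (set_powerM Gn hB1).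
  have s1 := right_vector_stable (u B2) fr Nl0 hB1 Gn.
  have s2 := left_vector_stable (w (G *m B1)) fr Nl0 hB2 Am.
  have s3 := bad l l B1 B2 (erefl _) hB1 hB2 eB.
  rewrite dotC; last exact: ip1.
  apply: le_trans s1 _; rewrite uu mulr1 dotC; last exact: ip1.
  apply: le_trans (lerD s2 (lexx _)) _; rewrite ww mulr1 -/drift.
  by have := le_trans s3 kl; set t := tau ^+ l; lra.
have a1 : 0 < a B1 := a_gt0 Nl0 hB1; have a2 : 0 < a B2 := a_gt0 Nl0 hB2.
have aB := norm_product_le Nl0 Nl0 hB1 hB2; rewrite -eB in aB.
apply: le_trans aB _.
(* one third of the exponent l = 3 N2 2^j absorbs the constant 3 + 2 drift *)
have tl : tau ^+ l = tau ^+ (N2 * 2 ^ j) * tau ^+ (2 * N2 * 2 ^ j).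
  by rewrite -exprD /l -mulnDl -mulSn.
have f1 : (3 + 2 * drift) * tau ^+ (N2 * 2 ^ j) <= 1.
  apply: le_trans hC; rewrite ler_wpM2l ?ler_wiXn2l ?ltW //.
    by have := drift_ge0; lra.
  by rewrite leq_pmulr // expn_gt0.
have f2 : beta B1 B2 + tau ^+ l + tau ^+ l <= tau ^+ (2 * N2 * 2 ^ j).
  apply: le_trans (_ : (3 + 2 * drift) * tau ^+ l <= _); first by lra.
  by rewrite tl mulrA ler_piMl.
set X := (_ * _) in h1 h2.
apply: le_trans (_ : (X ^+ (2 ^ j) * X ^+ (2 ^ j)) * tau ^+ (2 * N2 * 2 ^ j) <= _).
  apply: ler_pM => //.
  - by rewrite mulr_ge0 // ltW.
  - by rewrite !addr_ge0.
  by apply: ler_pM => //; exact: ltW.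
have -> : tau ^+ (2 * N2 * 2 ^ j) = (tau ^+ N2) ^+ (2 * 2 ^ j).
  by rewrite -exprM mulnA [(N2 * 2)%N]mulnC.
rewrite -exprD addnn -mul2n -exprMn.
by rewrite /X -mulrA -exprD mulnS addnC.
Qed.

(** Let L = 3 N2 2^k. If beta G A is small, write G = G1 P with P of length L. Moving up to
    L letters across the cut multiplies beta by at most K^(2L), so with delta small in
    terms of L all the cuts of P are bad. By [bad_word_norm] the norm of P is at most
    K^(3 N2 2^k) tau^(N2 k 2^k), but it is at least K^(-L). This is absurd as soon as
    K^6 tau^k < 1; so k depends on K and tau only, and L, delta, N are chosen after it. *)
Theorem transversality : exists delta N, [/\ 0 < delta, (N0 <= N)%N &
  forall n m G A, (N <= n)%N -> (N <= m)%N -> set_power S n G -> set_power S m A ->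
    delta <= beta G A].
Proof.
have t01 : 0 <= tau < 1 by rewrite ltW.
have c3 : 0 < (3 + 2 * drift)^-1 by rewrite invr_gt0; have := drift_ge0; lra.
have [M1 hM1] := expr_eventually_le t01 c3.
pose N2 := (maxn N0 M1).+1.
have hC : (3 + 2 * drift) * tau ^+ N2 <= 1.
  have h : tau ^+ N2 <= (3 + 2 * drift)^-1 by apply: hM1; rewrite leqW // leq_maxr.
  have c : 0 < 3 + 2 * drift by have := drift_ge0; lra.
  by rewrite mulrC -ler_pdivlMr // div1r.
have K6 : 0 < (2 * K ^+ 6)^-1 by rewrite invr_gt0 mulr_gt0 // exprn_gt0.
have [k hk] := expr_eventually_le t01 K6; have {}hk := hk k (leqnn k).
pose L := (3 * N2 * 2 ^ k)%N.
have KL : 0 < (K ^+ 2) ^+ L by rewrite !exprn_gt0.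
have tL : 0 < tau ^+ L by rewrite exprn_gt0.
pose delta := tau ^+ L / (K ^+ 2) ^+ L / 2.
have delta0 : 0 < delta by rewrite !divr_gt0.
have e0 : 0 < delta / (2 * L).+1%:R by rewrite divr_gt0.
have [M2 hM2] := expr_eventually_le t01 e0.
pose N := maxn N0 M2.
have N0N : (N0 <= N)%N by rewrite leq_maxl.
have tN : (2 * L)%:R * tau ^+ N <= delta.
  apply: le_trans (_ : (2 * L).+1%:R * tau ^+ N <= _).
    by rewrite ler_wpM2r // ler_nat.
  by rewrite mulrC -ler_pdivlMr //; apply: hM2; rewrite leq_maxr.
exists delta, (N + L)%N; split=> //; first by rewrite (leq_trans N0N) // leq_addr.
move=> n m G A Nn Nm Gn Am; rewrite leNgt; apply/negP => lt.
have [n' en] : exists n', (n = n' + L)%N.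
  by exists (n - L)%N; rewrite subnK // (leq_trans _ Nn) // leq_addl.
have Nn' : (N <= n')%N by move: Nn; rewrite en leq_add2r.
have {Nm} Nm : (N <= m)%N by rewrite (leq_trans _ Nm) // leq_addr.
rewrite en in Gn; have [G1 [P [hG1 hP eG]]] := set_power_split Gn.
have bad p q B1 B2 : (p + q = L)%N -> set_power S p B1 ->
    set_power S q B2 -> P = B1 *m B2 -> beta (G1 *m B1) (B2 *m A) <= tau ^+ L.
  move=> pq h1 h2 eP.
  have Np : (N <= n' + p)%N by rewrite (leq_trans Nn') // leq_addr.
  apply: le_trans (beta_shift N0N Np Nm (set_powerM hG1 h1) h2 Am) _.
  rewrite -mulmxA -eP -eG.
  have qL : (q <= L)%N by rewrite -pq leq_addl.
  have b : beta G A + (2 * q)%:R * tau ^+ N <= 2 * delta.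
    have : (2 * q)%:R * tau ^+ N <= delta.
      by apply: le_trans tN; rewrite ler_wpM2r // ler_nat leq_mul2l qL orbT.
    by move: lt; set b := `|_|; lra.
  apply: le_trans (_ : (K ^+ 2) ^+ L * (2 * delta) <= _).
    apply: ler_pM => //.
    - by rewrite exprn_ge0 // exprn_ge0 // ltW.
    - by rewrite addr_ge0 // mulr_ge0.
    by rewrite ler_weXn2l // exprn_ege1.
  rewrite le_eqVlt; apply/orP; left; apply/eqP; rewrite /delta.
  by field; rewrite gt_eqF.
have N2N : (N0 <= N2)%N by rewrite leqW // leq_maxl.
have ub := bad_word_norm (ltn0Sn _) N2N hC (leq_trans N0N Nn') (leq_trans N0N Nm)
  hG1 hP Am (lexx _) bad.
have NL : (N0 <= L)%N.
  by rewrite (leq_trans N2N) // /L mulnAC leq_pmull // muln_gt0 expn_gt0.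
have hPf := frame NL hP; have [[_ [_ ww]] _ _ hPn _] := hPf.
have := proj2 (set_power_bilipschitz K1 powS hP (w P)).
rewrite (near_rank_one_top hPf) (enorm_unit ww) leNgt => /negP; apply.
have KL' : 0 < K ^+ L by rewrite exprn_gt0.
apply: le_lt_trans (ler_wpM2l (ltW KL') ub) _.
rewrite /L [K ^+ (_ * 2 ^ k)]exprM -exprMn mulrA -exprD addnn -mul2n mulnA.
have h : K ^+ 6 * tau ^+ k < 1.
  have k6 : 0 < K ^+ 6 by rewrite exprn_gt0.
  have := ler_wpM2l (ltW k6) hk; rewrite invfM mulrCA divff ?gt_eqF // mulr1; lra.
have -> : K ^+ (6 * N2) * tau ^+ (N2 * k) = (K ^+ 6 * tau ^+ k) ^+ N2.
  by rewrite exprMn -!exprM [(N2 * k)%N]mulnC.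
rewrite -exprM exprn_ilt1 // ?mulr_ge0 ?exprn_ge0 ?ltW //.
by rewrite -lt0n muln_gt0 expn_gt0.
Qed.

End Transversality.

(** * Proximality of matrices of nearly rank one *)

Section RankOneDeterminant.
Variable F : comNzRingType.

(** Sylvester's determinant identity. The factor t replaces a division, so that the
    identity holds over polynomials. *)
Lemma det_rank_one n (t : F) (x : 'cV[F]_n) (y : 'rV[F]_n) :
  t * \det (t%:M - x *m y) = t ^+ n * (t - (y *m x) 0 0).
Proof.
pose A := block_mx (t%:M : 'M_n) x y (1%:M : 'M_1).
have h1 : \det A = \det (t%:M - x *m y).
  have -> : A = block_mx (t%:M - x *m y) x 0 1%:M *m block_mx 1%:M 0 y 1%:M.
    rewrite mulmx_block !(mul0mx, mulmx0, mulmx1, mul1mx, add0r, addr0).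
    by rewrite subrK.
  by rewrite det_mulmx det_ublock det_lblock !det1 !mulr1.
have h2 : A *m block_mx 1%:M (- x) 0 (t%:M : 'M_1) =
          block_mx t%:M 0 y (t%:M - y *m x).
  rewrite /A mulmx_block !(mul0mx, mulmx0, mulmx1, mul1mx, add0r, addr0).
  by rewrite mulmxN mul_scalar_mx mul_mx_scalar addNr mulmxN addrC.
have := congr1 determinant h2.
rewrite det_mulmx det_ublock det_lblock det1 mul1r !det_scalar h1 mulrC expr1.
by move=> ->; congr (_ * _); rewrite det_mx11 !mxE eqxx mulr1n.
Qed.

End RankOneDeterminant.

Section RealRoots.
Variable R : realType.

(** A monic polynomial is positive near +oo, so the intermediate value theorem applies. *)
Lemma monic_negative_root (p : {poly R}) t : p \is monic -> p.[t] <= 0 ->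
  exists2 x, t <= x & root p x.
Proof.
move=> mp pt; have lc0 : 0 < lead_coef p by rewrite (monicP mp) ltr01.
have [n hn] := poly_pinfty_gt_lc lc0.
pose s := Num.max n t.
have ps : 0 <= p.[s] by apply: le_trans (ltW lc0) (hn _ _); rewrite le_max lexx.
have ts : t <= s by rewrite le_max lexx orbT.
have [x] := @polyrcf.poly_ivt R p t s ts (mulr_le0_ge0 pt ps).
by rewrite in_itv /= => /andP[tx _] rx; exists x.
Qed.

Lemma horner_char_poly n (A : 'M[R]_n) t : (char_poly A).[t] = \det (t%:M - A).
Proof.
rewrite /char_poly -horner_evalE -det_map_mx; congr (\det _).
apply/matrixP => i j; rewrite !mxE /= /horner_eval !hornerE.
by case: (i == j); rewrite ?mulr1n ?mulr0n ?hornerE.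
Qed.

Lemma real_eigenvector n (A : 'M[R]_n) t : root (char_poly A) t ->
  exists2 v : 'cV[R]_n, 'N(v) = 1 & A *m v = t *: v.
Proof.
rewrite -char_poly_tr -eigenvalue_root_char => /eigenvalueP[v hv v0].
have nv : 0 < 'N(v^T).
  rewrite (enorm_gt0 ip1); apply: contra v0 => /eqP h.
  by rewrite -[v]trmxK h trmx0.
exists ('N(v^T)^-1 *: v^T).
  by rewrite (enormZ ip1) gtr0_norm ?invr_gt0 // mulVf // gt_eqF.
rewrite -scalemxAr -[A]trmxK -trmx_mul hv linearZ /=.
by rewrite !scalerA mulrC.
Qed.

End RealRoots.

Section Proximal.
Variables (R : realType) (d : nat).
Implicit Types (g : 'M[R]_d) (x y u w v l : 'cV[R]_d) (a eta delta lam : R).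

(** Let E be the error g - a u w^T, whose norm is at most eta a. For t > eta a the
    characteristic polynomial of E is positive, and that of g at t is its product with
    1 - a <w, (t - E)^-1 u>, which is close to 1 - a <w, u> / t. At t = a <w, u> / 2 this
    factor is close to -1, so g has an eigenvalue larger than t. *)
Lemma near_rank_one_eigenvalue_pos g a eta u w delta :
  near_rank_one g a eta u w -> 0 <= eta -> 0 < delta -> delta <= '[w, u] ->
  eta <= delta ^+ 2 / 16 ->
  exists2 lam, a * delta / 2 <= lam & root (char_poly g) lam.
Proof.
move=> hg eta0 d0 ds heta; have [[a0 [uu ww]] _ _ _ _] := hg.
set s := '[w, u] in ds; have s0 : 0 < s by lra.
have s1 : s <= 1.
  apply: le_trans (ler_norm _) _; apply: le_trans (dot_unit_le _ ww) _.
  by rewrite (enorm_unit uu).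
pose t := a * s / 2; have t0 : 0 < t by rewrite !divr_gt0 // mulr_gt0.
have he : eta <= s ^+ 2 / 16 by nra.
have he' : eta * a <= t / 4.
  rewrite /t; have : eta <= s / 8 by nra.
  by move=> h; have := ler_wpM2r (ltW a0) h; lra.
pose E := g - a *: (u *m w^T).
have EE x : E *m x = g *m x - (a * '[w, x]) *: u.
  rewrite /E mulmxBl -scalemxAl -mulmxA [w^T *m x]mx11_scalar mul_mx_scalar.
  by rewrite -standard_dotE scalerA.
have EN x : 'N(E *m x) <= eta * a * 'N(x).
  by have [r [h hr]] := near_rank_one_split hg x eta0; rewrite EE h addrC addKr.
(* otherwise E would have an eigenvalue larger than its norm *)
have posE : 0 < (char_poly E).[t].
  rewrite ltNge; apply/negP => /(monic_negative_root (char_poly_monic _)).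
  case=> b tb /real_eigenvector[v nv Ev]; have := EN v.
  rewrite Ev (enormZ ip1) nv !mulr1 ger0_norm; last by lra.
  by lra.
suff : (char_poly g).[t] <= 0.
  case/(monic_negative_root (char_poly_monic _)) => b tb rb; exists b => //.
  apply: le_trans tb; have := ler_wpM2l (ltW a0) ds; rewrite /t; lra.
have uB : t%:M - E \in unitmx.
  by rewrite unitmxE unitfE -horner_char_poly gt_eqF.
pose x := invmx (t%:M - E) *m u.
have hx : t *: x = u + E *m x.
  have : (t%:M - E) *m x = u by rewrite /x mulKVmx.
  by rewrite mulmxBl mul_scalar_mx => <-; rewrite subrK.
have nx : t * 'N(x) <= 1 + eta * a * 'N(x).
  have := congr1 (enorm 1%:M) hx; rewrite (enormZ ip1) gtr0_norm // => ->.
  by apply: le_trans (enormD ip1 _ _) _; rewrite (enorm_unit uu) lerD2l.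
have nx' : t * 'N(x) <= 4 / 3.
  have := ler_wpM2r (enorm_ge0 1%:M x) he'.
  by move: nx; set N := 'N(x); set e := eta * a; lra.
have wx : 1 <= a * '[w, x].
  have : t * '[w, x] = s + '[w, E *m x] by rewrite -dotZr hx dotDr.
  have := le_trans (dot_unit_le _ ww) (EN x).
  have : eta * a * 'N(x) <= s / 6.
    rewrite -(ler_pM2l t0).
    apply: le_trans (_ : (eta * a) * (4 / 3) <= _).
      by rewrite mulrCA ler_wpM2l // mulr_ge0 // ltW.
    rewrite /t; have := ler_wpM2r (ltW a0) he; lra.
  move=> h1 h2; have := ler_norm (- '[w, E *m x]); rewrite normrN => h3 h4.
  have : s * 5 / 6 <= t * '[w, x] by rewrite h4; lra.
  rewrite /t => h5; rewrite -(ler_pM2l s0); lra.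
have -> : (char_poly g).[t] = (char_poly E).[t] * (1 - a * '[w, x]).
  rewrite !horner_char_poly.
  have -> : t%:M - g = (t%:M - E) *m (1%:M - (a *: x) *m w^T).
    rewrite mulmxBr mulmx1 -scalemxAl -scalemxAr mulmxA.
    have -> : (t%:M - E) *m x = u by rewrite /x mulKVmx.
    by rewrite /E; apply/matrixP => i j; rewrite !mxE; ring.
  rewrite det_mulmx; congr (_ * _).
  have := det_rank_one 1 (a *: x) w^T; rewrite mul1r expr1n mul1r => ->.
  by rewrite -scalemxAr mxE -standard_dotE.
by apply: mulr_ge0_le0; [exact: ltW | lra].
Qed.

(** When <w, u> is negative, apply the positive case to - g and - u. *)
Lemma near_rank_one_eigenvalue g a eta u w delta :
  near_rank_one g a eta u w -> 0 <= eta -> 0 < delta -> delta <= `|'[w, u]| ->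
  eta <= delta ^+ 2 / 16 ->
  exists2 lam, a * delta / 2 <= `|lam| & root (char_poly g) lam.
Proof.
move=> hg eta0 d0 ds heta.
have [s0|s0] := leP 0 '[w, u].
  rewrite ger0_norm // in ds.
  have [lam h r] := near_rank_one_eigenvalue_pos hg eta0 d0 ds heta.
  exists lam => //; exact: le_trans h (ler_norm _).
rewrite ltr0_norm // in ds.
have hN : near_rank_one (- g) a eta (- u) w.
  have [[a0 [uu ww]] gw gu h1 h2] := hg; split.
  - by rewrite !(dotE ip1) opprK.
  - by rewrite mulNmx gw scalerN.
  - by rewrite [(- g)^T]linearN mulNmx mulmxN opprK.
  - by move=> x; rewrite mulNmx (enormN ip1).
  - by move=> x /h2; rewrite mulNmx (enormN ip1).
have ds' : delta <= '[w, - u] by rewrite dotNr.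
have [lam h r] := near_rank_one_eigenvalue_pos hN eta0 d0 ds' heta.
exists (- lam); first by rewrite normrN; apply: le_trans h (ler_norm _).
have [v nv hv] := real_eigenvector r.
have v0 : v != 0 by rewrite -(enorm_gt0 ip1) nv.
rewrite -char_poly_tr -eigenvalue_root_char; apply/eigenvalueP; exists v^T.
  by rewrite -trmx_mul -linearZ /= scaleNr -hv mulNmx opprK.
by apply: contra v0 => /eqP h0; rewrite -[v]trmxK h0 trmx0.
Qed.

(** Since lam v = g v is a multiple of u up to eta a, dividing by lam shows that v is a
    multiple of u up to 2 eta / delta. *)
Lemma large_eigenvector g a eta u w delta lam v :
  near_rank_one g a eta u w -> 0 <= eta -> 0 < delta ->
  a * delta / 2 <= `|lam| -> 'N(v) = 1 -> g *m v = lam *: v ->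
  exists c r, [/\ v = c *: u + r, 'N(r) <= 2 * eta / delta,
    1 - 2 * eta / delta <= `|c| & `|c| <= 1 + 2 * eta / delta].
Proof.
move=> hg eta0 d0 hl nv gv; have [[a0 [uu _]] _ _ _ _] := hg.
have ad : 0 < a * delta / 2 by rewrite divr_gt0 // mulr_gt0.
have l0 : 0 < `|lam| by apply: lt_le_trans hl.
have lam0 : lam != 0 by rewrite -normr_gt0.
have [r [h hr]] := near_rank_one_split hg v eta0.
pose c := lam^-1 * (a * '[w, v]).
have vE : v = c *: u + lam^-1 *: r.
  by rewrite /c -scalerA -scalerDr -h gv scalerA mulVf // scale1r.
have nr : 'N(lam^-1 *: r) <= 2 * eta / delta.
  rewrite (enormZ ip1) normfV mulrC ler_pdivrMr //.
  apply: le_trans hr _; rewrite nv mulr1.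
  have e0 : 0 <= 2 * eta / delta by rewrite divr_ge0 ?mulr_ge0 // ltW.
  apply: le_trans (_ : 2 * eta / delta * (a * delta / 2) <= _).
    by rewrite le_eqVlt; apply/orP; left; apply/eqP; field; rewrite gt_eqF.
  by rewrite ler_wpM2l.
exists c, (lam^-1 *: r); split=> //.
  have := enormD ip1 (c *: u) (lam^-1 *: r).
  by rewrite -vE nv (enormZ ip1) (enorm_unit uu) mulr1; lra.
have := enormBD ip1 v (lam^-1 *: r).
by rewrite {1}vE addrK nv (enormZ ip1) (enorm_unit uu) mulr1; lra.
Qed.

(** As nu is at most delta / 8, the error terms cost less than half of delta. *)
Lemma transverse_perturbation u w v l c r c' r' delta nu :
  '[u, u] = 1 -> '[w, w] = 1 -> 'N(v) = 1 ->
  v = c *: u + r -> l = c' *: w + r' -> 0 <= nu -> nu <= delta / 8 -> delta <= 1 ->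
  'N(r) <= nu -> 'N(r') <= nu -> 1 - nu <= `|c| -> 1 - nu <= `|c'| ->
  delta <= `|'[w, u]| -> delta / 2 <= `|'[l, v]|.
Proof.
move=> uu ww nv vE lE nu0 hnu d1 nr nr' hc hc' ds.
have wv : '[w, v] = c * '[w, u] + '[w, r] by rewrite vE dotDr dotZr.
have lv : '[l, v] = c' * '[w, v] + '[r', v] by rewrite lE dotDl ?dotZl //; exact: ip1.
have h1 : `|'[w, r]| <= nu by apply: le_trans (dot_unit_le _ ww) nr.
have h2 : `|'[r', v]| <= nu.
  by apply: le_trans (cauchy_schwarz ip1 _ _) _; rewrite nv mulr1.
have c7 : 7 / 8 <= `|c| by lra.
have c7' : 7 / 8 <= `|c'| by lra.
have h3 : 3 / 4 * delta <= `|'[w, v]|.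
  have := lerB_normD (c * '[w, u]) ('[w, r]); rewrite -wv normrM.
  have : 7 / 8 * delta <= `|c| * `|'[w, u]| by apply: ler_pM => //; lra.
  by set X := `|c| * _; lra.
have := lerB_normD (c' * '[w, v]) ('[r', v]); rewrite -lv normrM.
have : 7 / 8 * (3 / 4 * delta) <= `|c'| * `|'[w, v]| by apply: ler_pM => //; lra.
by set X := `|c'| * _; lra.
Qed.

End Proximal.

(** A matrix g with eigenvectors v and l, right and left, for the same eigenvalue lam,
    whose norm on the orthogonal of l is less than |lam|. The other eigenvalues are
    those of the deflated matrix g - lam v l^T / <l, v>. *)
Section Attractor.
Variables (R : realType) (d : nat) (g : 'M[R]_d) (lam b : R) (v l : 'cV[R]_d).
Hypotheses (gv : g *m v = lam *: v) (gl : g^T *m l = lam *: l).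
Hypotheses (lv : '[l, v] != 0) (b0 : 0 <= b) (blam : b < `|lam|).
Hypothesis contr : forall x, '[l, x] = 0 -> 'N(g *m x) <= b * 'N(x).

Let lam0 : lam != 0. Proof. by rewrite -normr_gt0 (le_lt_trans b0). Qed.

Let v0 : v != 0.
Proof. by apply: contraNneq lv => ->; rewrite dot0r. Qed.

Let l_g x : '[l, g *m x] = lam * '[l, x].
Proof. by rewrite dotC ?dot_trmx ?gl ?dotZr ?(dotC ip1 x) //; exact: ip1. Qed.

(** The component of x in the hyperplane orthogonal to l, along v. *)
Let hpart x : 'cV[R]_d := x - ('[l, x] / '[l, v]) *: v.

Let l_hpart x : '[l, hpart x] = 0.
Proof. by rewrite /hpart dotDr dotNr dotZr divfK // subrr. Qed.

Let deflated : 'M[R]_d := g - (lam / '[l, v]) *: (v *m l^T).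

Let deflatedE x : deflated *m x = g *m hpart x.
Proof.
rewrite /deflated /hpart mulmxBl mulmxBr -scalemxAl -scalemxAr gv.
rewrite -mulmxA [l^T *m x]mx11_scalar mul_mx_scalar -standard_dotE !scalerA.
by congr (_ - _ *: _); rewrite mulrAC [RHS]mulrAC [lam * _]mulrC.
Qed.

(** From X (X - g) = (X - deflated) (X - lam v l^T / <l, v>), since X - deflated maps v
    to X v; the determinant of the last factor is that of a rank one perturbation. *)
Let deflated_char_poly :
  'X * char_poly g = char_poly deflated * ('X - lam%:P).
Proof.
have X0 : ('X ^+ d : {poly R}) != 0 by rewrite expf_neq0 // polyX_eq0.
apply: (mulfI X0).
pose v' := map_mx polyC v; pose l' := map_mx polyC l^T.
pose k := (lam / '[l, v])%:P.
have hg : char_poly_mx g = char_poly_mx deflated - (k *: v') *m l'.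
  rewrite /char_poly_mx /deflated map_mxB map_mxZ map_mxM -scalemxAl -/v' -/l' -/k.
  by rewrite opprB addrA addrAC addrK.
have hv : char_poly_mx deflated *m v' = 'X *: v'.
  rewrite /char_poly_mx mulmxBl mul_scalar_mx -map_mxM deflatedE.
  rewrite /hpart divff // scale1r subrr mulmx0.
  by rewrite (_ : map_mx polyC 0 = 0) ?subr0 //; apply/matrixP => i j; rewrite !mxE.
have h : 'X%:M *m char_poly_mx g = char_poly_mx deflated *m ('X%:M - (k *: v') *m l').
  rewrite hg mulmxBr [RHS]mulmxBr mul_scalar_mx mul_mx_scalar; congr (_ - _).
  by rewrite mul_scalar_mx scalemxAl mulmxA -[_ *m (k *: v')]scalemxAr hv !scalerA mulrC.
have := congr1 determinant h; rewrite !det_mulmx det_scalar -/(char_poly g) => e.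
have := det_rank_one 'X (k *: v') l'.
have -> : (l' *m (k *: v')) 0 0 = lam%:P.
  rewrite -scalemxAr -map_mxM [LHS]mxE [X in _ * X]mxE -standard_dotE.
  by rewrite /k -polyCM divfK.
move=> e2; rewrite mulrCA e mulrCA e2.
by rewrite mulrCA mulrA mulrC mulrA.
Qed.

(** The image of the deflated matrix is orthogonal to l, so the real and imaginary parts
    of an eigenvector for a nonzero eigenvalue are too, and there the matrix is g. *)
Let deflated_eigenvalue z : z \in eigenvalues deflated ->
  `|z| < `|real_complex R lam|.
Proof.
have lamC : `|real_complex R lam| = real_complex R `|lam|.
  by rewrite normc_def /= expr0n addr0 sqrtr_sqr.
case/complex_eigenvector => p [q [pq hp hq]].
set al := complex.Re z in hp hq; set be := complex.Im z in hp hq.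
have zE : `|z| = real_complex R (Num.sqrt (al ^+ 2 + be ^+ 2)) by rewrite normc_def.
rewrite zE lamC ltcR -(sqrtr_sqr lam) ltr_sqrt; last first.
  by rewrite exprn_even_gt0.
have [z0|z0] := eqVneq (al ^+ 2 + be ^+ 2) 0.
  by rewrite z0 exprn_even_gt0.
have z1 : 0 < al ^+ 2 + be ^+ 2 by rewrite lt0r z0 addr_ge0 ?sqr_ge0.
have lx x : '[l, deflated *m x] = 0 by rewrite deflatedE l_g l_hpart mulr0.
have e1 : al * '[l, p] - be * '[l, q] = 0.
  by rewrite -!dotZr -dotNr -dotDr -hp lx.
have e2 : be * '[l, p] + al * '[l, q] = 0.
  by rewrite -!dotZr -dotDr -hq lx.
have lp : '[l, p] = 0.
  apply: (mulfI z0); rewrite mulr0.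
  transitivity (al * (al * '[l, p] - be * '[l, q]) + be * (be * '[l, p] + al * '[l, q])).
    by ring.
  by rewrite e1 e2 !mulr0 addr0.
have lq : '[l, q] = 0.
  apply: (mulfI z0); rewrite mulr0.
  transitivity (- be * (al * '[l, p] - be * '[l, q]) + al * (be * '[l, p] + al * '[l, q])).
    by ring.
  by rewrite e1 e2 !mulr0 addr0.
have nE x : '[l, x] = 0 -> '[deflated *m x, deflated *m x] <= b ^+ 2 * '[x, x].
  move=> hx; rewrite deflatedE /hpart hx mul0r scale0r subr0 -!(enorm_sq ip1) -exprMn.
  by rewrite ler_pXn2r ?nnegrE ?mulr_ge0 ?enorm_ge0 // contr.
have := lerD (nE _ lp) (nE _ lq); rewrite -mulrDr hp hq !(dotE ip1) (dotC ip1 q p).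
move=> h.
have {}h : (al ^+ 2 + be ^+ 2) * ('[p, p] + '[q, q]) <= b ^+ 2 * ('[p, p] + '[q, q]).
  by apply: le_trans h; rewrite le_eqVlt; apply/orP; left; apply/eqP; ring.
rewrite ler_pM2r // in h; apply: le_lt_trans h _.
by rewrite -(real_normK (num_real lam)) ltr_pXn2r ?nnegrE.
Qed.

(** By [deflated_char_poly], the eigenvalues of g and 0 are together those of the deflated
    matrix and lam. *)
Lemma attractor_dominant : dominant_eigenvalue g (real_complex R lam).
Proof.
have := deflated_char_poly => /(congr1 (map_poly (real_complex R))).
rewrite !rmorphM /= map_polyX map_polyXsubC !map_char_poly !char_poly_eigenvalues.
move=> h.
have hp : perm_eq (0 :: eigenvalues g) (real_complex R lam :: eigenvalues deflated).
  by apply: prod_XsubC_eq; rewrite !big_cons subr0 h mulrC.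
have lamin : real_complex R lam \in eigenvalues g.
  have : real_complex R lam \in 0 :: eigenvalues g by rewrite (perm_mem hp) mem_head.
  by rewrite inE => /orP[/eqP/complexI/eqP|//]; rewrite (negPf lam0).
exists (rem (real_complex R lam) (eigenvalues g)); split; first exact: perm_to_rem.
move=> w hw; apply: deflated_eigenvalue.
have : perm_eq (0 :: rem (real_complex R lam) (eigenvalues g)) (eigenvalues deflated).
  rewrite -(perm_cons (real_complex R lam)); apply: perm_trans hp.
  apply: perm_trans (_ : perm_eq _
    (0 :: real_complex R lam :: rem (real_complex R lam) (eigenvalues g))) _.
    by rewrite -cat1s -[0 :: _]cat1s -[X in perm_eq _ X]cat1s
      -[X in perm_eq _ (_ ++ X)]cat1s perm_catCA.
  by rewrite perm_cons perm_sym perm_to_rem.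
by move/perm_mem => <-; rewrite inE hw orbT.
Qed.

Lemma dominant_eigenvalue_unique z1 z2 :
  dominant_eigenvalue g z1 -> dominant_eigenvalue g z2 -> z1 = z2.
Proof.
case=> s1 [p1 h1] [s2 [p2 h2]].
have m1 : z1 \in z2 :: s2 by rewrite -(perm_mem p2) (perm_mem p1) mem_head.
have m2 : z2 \in z1 :: s1 by rewrite -(perm_mem p1) (perm_mem p2) mem_head.
move: m1 m2; rewrite !inE => /orP[/eqP //|/h2 l1] /orP[/eqP //|/h1 l2].
by have := lt_trans l1 l2; rewrite ltxx.
Qed.

Lemma attractor_eigenspace : passmx.leigenspace (lin g) lam = <[v]>%VS.
Proof.
apply/vspaceP => x; rewrite /passmx.leigenspace memv_ker.
rewrite add_lfunE opp_lfunE scale_lfunE id_lfunE /lin lfunE /= subr_eq0.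
apply/eqP/vlineP => [gx|[k ->]]; last by rewrite -scalemxAr gv !scalerA mulrC.
exists ('[l, x] / '[l, v]).
have hx : g *m hpart x = lam *: hpart x.
  by rewrite /hpart mulmxBr gx -scalemxAr gv scalerBr !scalerA [lam * _]mulrC.
apply/eqP; rewrite -subr_eq0 -/(hpart x); apply/negP => h0.
have := contr (l_hpart x); rewrite hx (enormZ ip1) leNgt => /negP; apply.
by rewrite ltr_pM2r // (enorm_gt0 ip1); apply/negP.
Qed.

Lemma attracting_lineE : attracting_line g = <[v]>%VS.
Proof.
apply: xget_unique.
  by exists lam; split; [exact: attractor_dominant | rewrite attractor_eigenspace].
move=> L [a [ha ->]]; rewrite -attractor_eigenspace; congr passmx.leigenspace.
exact/complexI/(dominant_eigenvalue_unique ha attractor_dominant).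
Qed.

(** The repelling hyperplane is the kernel of the left eigenvector: an invariant
    complement H of the eigenline is mapped bijectively to itself by g - lam,
    whose image is orthogonal to l. *)
Lemma mem_repelling_hyperplane x : (x \in repelling_hyperplane g) = ('[l, x] == 0).
Proof.
pose H0 := lker (lin (l *m l^T)).
have l0 : l != 0 by apply: contraNneq lv => ->; rewrite dot0l //; exact: ip1.
have H0E y : (y \in H0) = ('[l, y] == 0).
  rewrite memv_ker /lin lfunE /= -mulmxA [l^T *m y]mx11_scalar mul_mx_scalar.
  by rewrite -standard_dotE scaler_eq0 (negPf l0) orbF.
have ex : [set H | [/\ (lin g @: H <= H)%VS,
    (attracting_line g :&: H = 0)%VS & (attracting_line g + H = fullv)%VS]] H0.
  rewrite attracting_lineE; split.
  - apply/subvP => y /memv_imgP[z]; rewrite H0E => /eqP hz ->.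
    by rewrite H0E /lin lfunE /= l_g hz mulr0.
  - apply/eqP; rewrite -subv0; apply/subvP => y; rewrite memv_cap H0E memv0.
    case/andP => /vlineP[k ->]; rewrite dotZr mulf_eq0 (negPf lv) orbF => /eqP ->.
    by rewrite scale0r.
  - apply/eqP; rewrite eqEsubv subvf; apply/subvP => y _; apply/memv_addP.
    exists (('[l, y] / '[l, v]) *: v); first by apply/vlineP; eexists.
    exists (hpart y); first by rewrite H0E l_hpart.
    by rewrite /hpart addrC subrK.
have [] := xgetPex 0%VS (ex_intro _ H0 ex).
rewrite -/(repelling_hyperplane g); set H := repelling_hyperplane g.
rewrite attracting_lineE => Hinv Hcap Hsum.
have HS y : y \in H -> '[l, y] = 0.
  pose f := (lin g - lam *: \1)%VF.
  have fE z : f z = g *m z - lam *: z.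
    by rewrite /f add_lfunE opp_lfunE scale_lfunE id_lfunE /lin lfunE.
  have fH : (f @: H = H)%VS.
    apply/eqP; rewrite eqEdim; apply/andP; split.
      apply/subvP => z /memv_imgP[t tH ->]; rewrite fE memvB ?memvZ //.
      by apply: (subvP Hinv); rewrite -[g *m t](lfunE (mulmx g)) memv_img.
    rewrite limg_dim_eq //; apply/eqP; rewrite -subv0 -Hcap capvC.
    by rewrite -attractor_eigenspace subvv.
  rewrite -{1}fH => /memv_imgP[z _ ->]; rewrite fE dotDr dotNr l_g dotZr.
  by rewrite subrr.
apply/idP/eqP => [/HS //|lx].
have : x \in (<[v]> + H)%VS by rewrite Hsum memvf.
case/memv_addP => y /vlineP[k ->] [z zH xE]; move: lx.
rewrite xE dotDr dotZr (HS _ zH) addr0 => /eqP.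
by rewrite mulf_eq0 (negPf lv) orbF => /eqP ->; rewrite scale0r add0r.
Qed.

End Attractor.

Section CloseTo.
Variables (R : realType) (d : nat).
Implicit Types (x y u w v l : 'cV[R]_d).

(** x is a multiple, of size about 1, of y, up to nu. *)
Definition close_to (nu : R) x y : Prop := exists c r,
  [/\ x = c *: y + r, 'N(r) <= nu, 1 - nu <= `|c| & `|c| <= 1 + nu].

Lemma transverse_close_to u w v l (delta nu : R) :
  '[u, u] = 1 -> '[w, w] = 1 -> 'N(v) = 1 -> 0 <= nu -> nu <= delta / 8 ->
  close_to nu v u -> close_to nu l w ->
  delta <= `|'[w, u]| -> delta / 2 <= `|'[l, v]|.
Proof.
move=> uu ww nv nu0 hnu [c [r [vE hr hc _]]] [c' [r' [lE hr' hc' _]]] hd.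
have d1 : delta <= 1.
  by apply: le_trans hd (le_trans (dot_unit_le _ ww) _); rewrite (enorm_unit uu).
exact: (transverse_perturbation uu ww nv vE lE nu0 hnu d1 hr hr' hc hc' hd).
Qed.

(** The left eigenvector comes from the same argument for g^T. Since l is close to w, a
    vector orthogonal to l is nearly orthogonal to w, so g contracts it. *)
Theorem near_rank_one_attractor g a eta u w (delta : R) :
  near_rank_one g a eta u w -> 0 <= eta -> 0 < delta -> delta <= `|'[w, u]| ->
  eta <= delta ^+ 2 / 16 ->
  exists v l, [/\ 'N(v) = 1 /\ 'N(l) = 1,
    close_to (2 * eta / delta) v u, close_to (2 * eta / delta) l w,
    proximal g /\ attracting_line g = <[v]>%VS &
    forall x, (x \in repelling_hyperplane g) = ('[l, x] == 0)].
Proof.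
move=> hg eta0 d0 hd heta; have [[a0 [uu ww]] _ _ _ _] := hg.
have d1 : delta <= 1.
  by apply: le_trans hd (le_trans (dot_unit_le _ ww) _); rewrite (enorm_unit uu).
have [lam hlam rlam] := near_rank_one_eigenvalue hg eta0 d0 hd heta.
have [v nv gv] := real_eigenvector rlam.
have [l nl gl] : exists2 l, 'N(l) = 1 & g^T *m l = lam *: l.
  by apply: real_eigenvector; rewrite char_poly_tr.
have cv := large_eigenvector hg eta0 d0 hlam nv gv.
have cl := large_eigenvector (near_rank_one_tr hg eta0) eta0 d0 hlam nl gl.
set nu := 2 * eta / delta in cv cl.
have nu0 : 0 <= nu by rewrite divr_ge0 ?mulr_ge0 // ltW.
have nu8 : nu <= delta / 8 by rewrite /nu ler_pdivrMr //; lra.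
have lv : '[l, v] != 0.
  have := transverse_close_to uu ww nv nu0 nu8 cv cl hd.
  by rewrite -normr_gt0; lra.
pose b := 5 / 2 * nu * a.
have b0 : 0 <= b by apply: mulr_ge0; [apply: mulr_ge0; lra | exact: ltW].
have blam : b < `|lam|.
  apply: lt_le_trans hlam; rewrite /b.
  by have := ler_wpM2r (ltW a0) nu8; have := mulr_gt0 a0 d0; lra.
have contr x : '[l, x] = 0 -> 'N(g *m x) <= b * 'N(x).
  move=> lx; apply: le_trans (near_rank_one_le hg x eta0) _.
  have [c [r [lE hr hc _]]] := cl.
  have wx : 7 / 8 * `|'[w, x]| <= nu * 'N(x).
    apply: le_trans (_ : `|c| * `|'[w, x]| <= _).
      by rewrite ler_wpM2r //; lra.
    have -> : `|c| * `|'[w, x]| = `|'[r, x]|.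
      rewrite -normrM -normrN; congr `|_|; apply/eqP.
      rewrite -subr_eq0 -opprD oppr_eq0 -(dotZl ip1) -(dotDl ip1) -lE.
      by rewrite lx.
    apply: le_trans (cauchy_schwarz ip1 _ _) _.
    by rewrite ler_wpM2r ?enorm_ge0.
  have en : eta * 'N(x) <= nu / 2 * 'N(x).
    rewrite ler_wpM2r ?enorm_ge0 //.
    have -> : nu / 2 = eta / delta by rewrite /nu; field; rewrite gt_eqF.
    by rewrite ler_pdivlMr // ler_piMr.
  have := mulr_ge0 nu0 (enorm_ge0 1%:M x) => nN.
  apply: le_trans (_ : a * (5 / 2 * (nu * 'N(x))) <= _); last first.
    by rewrite le_eqVlt; apply/orP; left; apply/eqP; rewrite /b; ring.
  by rewrite ler_pM2l //; lra.
exists v, l; split=> //.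
  split; last exact: (attracting_lineE gv gl lv b0 blam contr).
  by eexists; exact: (attractor_dominant gv gl lv b0 blam contr).
exact: (mem_repelling_hyperplane gv gl lv b0 blam contr).
Qed.

End CloseTo.

(** * Distances between lines *)

Section Lines.
Variables (R : realType) (d : nat) (Q : 'M[R]_d).
Hypothesis hQ : inner_product_matrix Q.
Implicit Types (x y : 'cV[R]_d) (L H : {vspace 'cV[R]_d}).

Lemma vpick_vline x : x != 0 -> exists2 k, k != 0 & vpick <[x]>%VS = k *: x.
Proof.
move=> x0; have /vlineP[k hk] := memv_pick <[x]>%VS; exists k => //.
have : vpick <[x]>%VS != 0.
  by rewrite vpick0 -dimv_eq0 dim_vline x0.
by rewrite hk; apply: contraNneq => ->; rewrite scale0r.
Qed.

Lemma pdist_vline x y : x != 0 -> y != 0 ->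
  pdist Q <[x]>%VS <[y]>%VS = sine Q x y.
Proof.
move=> x0 y0; rewrite /pdist -/(sine Q _ _).
have [k k0 ->] := vpick_vline x0; have [k' k'0 ->] := vpick_vline y0.
exact: sineZ.
Qed.

Lemma vline_vpick L : \dim L = 1%N -> vpick L != 0 /\ L = <[vpick L]>%VS.
Proof.
move=> L1; have p0 : vpick L != 0 by rewrite vpick0 -dimv_eq0 L1.
split=> //; apply/eqP; rewrite eq_sym eqEdim -memvE memv_pick /=.
by rewrite dim_vline p0 L1.
Qed.

Lemma proj_vline x H : x != 0 -> x \in H -> proj H <[x]>%VS.
Proof. by move=> x0 xH; rewrite /proj /= dim_vline x0 -memvE. Qed.

Lemma pdist_set_ge (c : R) x H : x != 0 ->
  (exists2 y, y != 0 & y \in H) ->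
  (forall y, y != 0 -> y \in H -> c <= sine Q x y) ->
  c <= pdist_set Q <[x]>%VS (proj H).
Proof.
move=> x0 [y y0 yH] hc; apply: lb_le_inf.
  by exists (pdist Q <[x]>%VS <[y]>%VS), <[y]>%VS; first exact: proj_vline.
move=> _ [M [M1 MH] <-]; have [p0 ME] := vline_vpick M1.
rewrite ME pdist_vline //; apply: hc => //.
by apply: (subvP MH); exact: memv_pick.
Qed.

Lemma pdist_set_le x y H : x != 0 -> y != 0 -> y \in H ->
  pdist_set Q <[x]>%VS (proj H) <= sine Q x y.
Proof.
move=> x0 y0 yH; rewrite -pdist_vline //; apply: ge_inf.
  exists 0 => _ [M _ <-].
  by rewrite divr_ge0 ?mulr_ge0 ?sqrtr_ge0.
by exists <[y]>%VS => //; exact: proj_vline.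
Qed.

End Lines.

Section CompareInnerProducts.
Variables (R : realType) (d : nat) (Q Q' : 'M[R]_d) (C : R).
Hypotheses (hQ : inner_product_matrix Q) (hQ' : inner_product_matrix Q').
Hypotheses (C1 : 1 <= C) (QQ' : forall x, enorm Q x <= C * enorm Q' x).
Hypothesis (Q'Q : forall x, enorm Q' x <= C * enorm Q x).

Let C0 : 0 < C. Proof. by have := C1; lra. Qed.

Lemma wedge_compare x y : wedge_norm Q x y <= C ^+ 2 * wedge_norm Q' x y.
Proof.
have [->|y0] := eqVneq y 0.
  rewrite (le_trans (wedge_le hQ _ _)) ?(enorm0 hQ) ?mulr0 //.
  by rewrite mulr_ge0 ?wedge_ge0 // exprn_ge0 // ltW.
have [t [-> _ _]] := wedge_height hQ' x y0.
apply: le_trans (wedge_le_height hQ x y t) _.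
have := ler_pM (enorm_ge0 _ _) (enorm_ge0 _ _) (QQ' (x - t *: y)) (QQ' y).
by move/le_trans; apply; rewrite le_eqVlt; apply/orP; left; apply/eqP; ring.
Qed.

Lemma sine_compare x y : sine Q x y <= C ^+ 4 * sine Q' x y.
Proof.
have [->|x0] := eqVneq x 0.
  by rewrite {1}/sine (enorm0 hQ) mul0r invr0 mulr0 mulr_ge0 ?sine_ge0 // exprn_ge0 // ltW.
have [->|y0] := eqVneq y 0.
  by rewrite {1}/sine (enorm0 hQ) mulr0 invr0 mulr0 mulr_ge0 ?sine_ge0 // exprn_ge0 // ltW.
have nx : 0 < enorm Q x by rewrite (enorm_gt0 hQ).
have ny : 0 < enorm Q y by rewrite (enorm_gt0 hQ).
have nx' : 0 < enorm Q' x by rewrite (enorm_gt0 hQ').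
have ny' : 0 < enorm Q' y by rewrite (enorm_gt0 hQ').
rewrite /sine ler_pdivrMr ?mulr_gt0 //.
apply: le_trans (wedge_compare x y) _.
set W := wedge_norm Q' x y.
have -> : C ^+ 4 * (W / (enorm Q' x * enorm Q' y)) * (enorm Q x * enorm Q y) =
  C ^+ 2 * W * ((C * enorm Q x) * (C * enorm Q y) / (enorm Q' x * enorm Q' y)).
  by field; rewrite !gt_eqF.
rewrite ler_peMr ?mulr_ge0 ?wedge_ge0 ?exprn_ge0 ?(ltW C0) //.
rewrite ler_pdivlMr ?mulr_gt0 // mul1r.
by apply: ler_pM; rewrite ?enorm_ge0.
Qed.

End CompareInnerProducts.

(** * From domination to Schottky families *)

Section SingularFrames.
Variables (R : realType) (d : nat).
Implicit Types (x y u w v l : 'cV[R]_d) (g : 'M[R]_d) (S : set 'M[R]_d).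

Lemma near_rank_one_weaken g (a eta eta' : R) u w : eta <= eta' ->
  near_rank_one g a eta u w -> near_rank_one g a eta' u w.
Proof.
move=> h [[a0 [uu ww]] gw gu h1 h2]; split=> // x /h2 hx; apply: le_trans hx _.
by rewrite ler_wpM2r ?enorm_ge0 // ler_wpM2r // ltW.
Qed.

Lemma set_power_nonempty S n : (exists s, S s) -> exists g, set_power S n g.
Proof. by case=> s Ss; eexists; exists (fun=> s); split. Qed.

(** The rate 1 - e may not be positive. It is nonnegative if S is nonempty, because
    the ratio of singular values is nonnegative and n can be odd; and it can be enlarged
    to a number in (0, 1). *)
Lemma dominated_frame_exists S : (2 <= d)%N -> relatively_compact_in_GL S ->
  one_dominated S ->
  exists K tau N0 a (u w : 'M[R]_d -> 'cV[R]_d), dominated_frame S K tau N0 a u w.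
Proof.
move=> d2 hS [e [e0 [N _ hN]]].
have [K K1 hK] := relatively_compact_bilipschitz hS.
have [u [w huw]] := singular_frame R d2.
have sv0 g : 0 <= singular_value 2 g / singular_value 1 g.
  have [e1 [e2 /= [_ [a1 a2 _] _ _ _]]] := singular_vectors g d2.
  exact: divr_ge0.
pose tau := Num.max (1 - e) (1 / 2).
exists K, tau, N.+1, (singular_value 1), u, w; split=> //.
- rewrite lt_max gt_max; apply/andP; split; last by apply/andP; split; lra.
  by apply/orP; right; lra.
- by case: hS.
move=> n g Nn gn; apply: near_rank_one_weaken (huw _ _); last first.
  by apply: set_power_unit gn; case: hS.
have e1 : 0 <= 1 - e.
  rewrite leNgt; apply/negP => neg.
  have [s Ss] : exists s, S s.
    case: n gn Nn => // n /set_powerS[s [b [Ss _ _]]] _; by exists s.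
  have [h hh] := @set_power_nonempty S (2 * N).+1 (ex_intro _ s Ss).
  have NN : (N <= (2 * N).+1)%N by rewrite leqW // leq_pmull.
  have := le_trans (sv0 h) (hN _ NN _ hh).
  by rewrite leNgt exprn_odd_lt0 ?neg //= oddM.
apply: le_trans (hN n (ltnW Nn) _ gn) _.
by rewrite lerXn2r ?nnegrE // le_max ?lexx ?e1.
Qed.

(** Replace y by the combination z of x and y orthogonal to w: then g x /\ g z is
    <w, x> g x /\ g y, its norm is at most |g x| |g z|, and g z is of order eta a. *)
Lemma sine_contraction g (a eta k : R) u w x y :
  near_rank_one g a eta u w -> 0 <= eta -> 0 < k -> x != 0 -> y != 0 ->
  k * 'N(x) <= `|'[w, x]| -> k * 'N(y) <= `|'[w, y]| ->
  sine 1%:M (g *m x) (g *m y) <= 2 * eta / k ^+ 2 * sine 1%:M x y.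
Proof.
move=> hg eta0 k0 x0 y0 hx hy; have [[a0 [uu ww]] _ _ _ h] := hg.
have nx : 0 < 'N(x) by rewrite (enorm_gt0 ip1).
have ny : 0 < 'N(y) by rewrite (enorm_gt0 ip1).
have wx : 0 < `|'[w, x]| by apply: lt_le_trans hx; rewrite mulr_gt0.
have wy : 0 < `|'[w, y]| by apply: lt_le_trans hy; rewrite mulr_gt0.
have ngx : 0 < 'N(g *m x).
  by apply: lt_le_trans (near_rank_one_ge hg x); rewrite mulr_gt0.
have ngy : 0 < 'N(g *m y).
  by apply: lt_le_trans (near_rank_one_ge hg y); rewrite mulr_gt0.
set W := wedge_norm 1%:M x y; have W0 : 0 <= W by exact: wedge_ge0.
pose z := '[w, x] *: y - '[w, y] *: x.
have wz : '[w, z] = 0 by rewrite /z dotDr dotNr !dotZr; ring.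
have gz : g *m z = - '[w, y] *: (g *m x) + '[w, x] *: (g *m y).
  by rewrite /z mulmxBr -!scalemxAr scaleNr addrC.
have h1 : `|'[w, x]| * wedge_norm 1%:M (g *m x) (g *m y) <=
    'N(g *m x) * (eta * a * (2 * W)).
  rewrite -(wedge_combine ip1 _ _ (- '[w, y])) -gz.
  apply: le_trans (wedge_le ip1 _ _) _; rewrite ler_pM2l //.
  apply: le_trans (h _ wz) _; rewrite ler_wpM2l ?mulr_ge0 ?(ltW a0) //.
  have := wedge_contract ip1 w x y; rewrite -/z -/W (enorm_unit ww) mulr1.
  by [].
have h2 := near_rank_one_ge hg y.
rewrite {1}/sine ler_pdivrMr ?mulr_gt0 // -(ler_pM2l wx).
apply: le_trans h1 _; rewrite /sine -/W.
have -> : `|'[w, x]| * (2 * eta / k ^+ 2 * (W / ('N(x) * 'N(y))) *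
    ('N(g *m x) * 'N(g *m y))) = 'N(g *m x) * (2 * eta * W) *
  ((`|'[w, x]| * 'N(g *m y)) / ((k * 'N(x)) * (k * 'N(y)))).
  by field; rewrite !gt_eqF.
have -> : 'N(g *m x) * (eta * a * (2 * W)) = 'N(g *m x) * (2 * eta * W) * a by ring.
apply: ler_wpM2l; first by rewrite !mulr_ge0 // ltW.
rewrite ler_pdivlMr ?mulr_gt0 // mulrCA.
apply: ler_pM => //; rewrite ?mulr_ge0 ?(ltW a0) ?(ltW k0) ?(ltW nx) ?(ltW ny) //.
by apply: le_trans h2; rewrite ler_pM2l.
Qed.

End SingularFrames.

Section SchottkyConstants.
Variables (R : realType) (d : nat) (Q : 'M[R]_d) (C : R).
Hypotheses (d2 : (2 <= d)%N) (hQ : inner_product_matrix Q) (hC : 1 <= C).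
Hypotheses (C1 : forall x, enorm Q x <= C * 'N(x)).
Hypothesis (C2 : forall x, 'N(x) <= C * enorm Q x).
Implicit Types (x y u w v l : 'cV[R]_d) (g : 'M[R]_d) (H : {vspace 'cV[R]_d}).

Let C0 : 0 < C. Proof. by have := hC; lra. Qed.
Let C4 : 0 < C ^+ 4. Proof. by rewrite exprn_gt0. Qed.

Lemma hyperplane_nonzero l H : (forall x, (x \in H) = ('[l, x] == 0)) ->
  exists2 y, y != 0 & y \in H.
Proof.
move=> HE; pose i := Ordinal (ltnW d2); pose j := Ordinal d2.
pose e k : 'cV[R]_d := delta_mx k 0.
have le k : '[l, e k] = l k 0 by rewrite standard_dotE -colE !mxE.
have e0 k : e k != 0.
  by apply/eqP => /matrixP/(_ k 0); rewrite !mxE !eqxx => /eqP; rewrite oner_eq0.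
have [h|h] := eqVneq (l i 0) 0.
  by exists (e i) => //; rewrite HE le h.
exists (l j 0 *: e i - l i 0 *: e j).
  apply/eqP => /matrixP/(_ j 0); rewrite !mxE !eqxx /= => /eqP.
  by rewrite mulr0 mulr1 add0r oppr_eq0 (negPf h).
by rewrite HE dotDr dotNr !dotZr !le mulrC subrr.
Qed.

(** For y orthogonal to l, the vector v - t y has the same scalar product with l as v, so
    it is at least as long as that scalar product. *)
Lemma pdist_hyperplane_ge v l H c : (forall x, (x \in H) = ('[l, x] == 0)) ->
  'N(v) = 1 -> 'N(l) = 1 -> c <= `|'[l, v]| ->
  c / C ^+ 4 <= pdist_set Q <[v]>%VS (proj H).
Proof.
move=> HE nv nl hc; have v0 : v != 0 by rewrite -(enorm_gt0 ip1) nv.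
apply: pdist_set_ge => //; first exact: hyperplane_nonzero HE.
move=> y y0; rewrite HE => /eqP ly; rewrite ler_pdivrMr // mulrC.
apply: le_trans (sine_compare ip1 hQ hC C2 C1 v y).
have [t [-> _]] := sine_height ip1 v0 y0; rewrite nv divr1.
apply: le_trans hc _; have -> : '[l, v] = '[l, v - t *: y].
  by rewrite dotDr dotNr dotZr ly mulr0 subr0.
by apply: le_trans (cauchy_schwarz ip1 _ _) _; rewrite nl mul1r.
Qed.

(** The line of x is compared with the line of its orthogonal projection m to the
    hyperplane, which is degenerate when x is a multiple of l. *)
Lemma far_from_hyperplane e x l H : (forall x, (x \in H) = ('[l, x] == 0)) ->
  'N(l) = 1 -> x != 0 -> e <= 1 -> e <= pdist_set Q <[x]>%VS (proj H) ->
  e / C ^+ 4 * 'N(x) <= `|'[l, x]|.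
Proof.
move=> HE nl x0 e1 he; have nx : 0 < 'N(x) by rewrite (enorm_gt0 ip1).
have ll : '[l, l] = 1 by rewrite -(enorm_sq ip1) nl expr1n.
have [lm _ _] := orthogonal_part x ll; set m := x - _ in lm.
have xm : x - 1 *: m = '[l, x] *: l by rewrite scale1r /m subKr.
have nxm : 'N(x - 1 *: m) = `|'[l, x]| by rewrite xm (enormZ ip1) nl mulr1.
have [m0|m0] := eqVneq m 0.
  rewrite -nxm m0 scaler0 subr0 ler_piMl ?enorm_ge0 //.
  by rewrite ler_pdivrMr // mul1r (le_trans e1) // exprn_ege1.
have mH : m \in H by rewrite HE lm.
have := le_trans he (le_trans (pdist_set_le hQ x0 m0 mH) (sine_compare hQ ip1 hC C1 C2 x m)).
move=> h; have := le_trans h (ler_wpM2l (ltW C4) (sine_le_height ip1 x 1 m0)).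
rewrite nxm mulrA ler_pdivlMr // => h3.
by rewrite mulrAC ler_pdivrMr // [leRHS]mulrC.
Qed.

Lemma close_to_dot nu k l w x : close_to nu l w -> nu <= 1 -> nu <= k / 2 ->
  k * 'N(x) <= `|'[l, x]| -> k / 4 * 'N(x) <= `|'[w, x]|.
Proof.
move=> [c [r [lE hr _ hc]]] n1 nk; rewrite lE (dotDl ip1) (dotZl ip1) => h.
have h1 := ler_normD (c * '[w, x]) '[r, x].
have h2 : `|c * '[w, x]| <= 2 * `|'[w, x]|.
  by rewrite normrM ler_wpM2r //; lra.
have h3 : `|'[r, x]| <= k / 2 * 'N(x).
  apply: le_trans (cauchy_schwarz ip1 _ _) _; rewrite ler_wpM2r ?enorm_ge0 //.
  exact: le_trans hr nk.
lra.
Qed.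

(** Lines far from the orthogonal of l are far from the orthogonal of w, where
    [sine_contraction] applies; the powers of C come from the passage between Q and the
    standard inner product. *)
Lemma near_rank_one_contraction g (a eta nu e : R) u w l x y :
  near_rank_one g a eta u w -> 0 <= eta -> 'N(l) = 1 -> close_to nu l w ->
  (forall x, (x \in repelling_hyperplane g) = ('[l, x] == 0)) ->
  0 < e -> e <= 1 -> nu <= 1 -> nu <= e / C ^+ 4 / 2 ->
  eta <= e ^+ 3 / (32 * C ^+ 16) ->
  x != 0 -> y != 0 -> g *m x != 0 -> g *m y != 0 ->
  e <= pdist_repelling Q <[x]>%VS g -> e <= pdist_repelling Q <[y]>%VS g ->
  pdist Q (lin g @: <[x]>)%VS (lin g @: <[y]>)%VS <= e * pdist Q <[x]>%VS <[y]>%VS.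
Proof.
move=> hg eta0 nl cl HE e0 e1 n1 nue heta x0 y0 gx0 gy0 hx hy.
rewrite !limg_line /lin !lfunE /= !pdist_vline //.
pose k := e / C ^+ 4 / 4; have k0 : 0 < k by rewrite !divr_gt0.
have kx := close_to_dot cl n1 nue (far_from_hyperplane HE nl x0 e1 hx).
have ky := close_to_dot cl n1 nue (far_from_hyperplane HE nl y0 e1 hy).
apply: le_trans (sine_compare hQ ip1 hC C1 C2 _ _) _.
apply: le_trans (ler_wpM2l (ltW C4) (sine_contraction hg eta0 k0 x0 y0 kx ky)) _.
have sc := sine_compare ip1 hQ hC C2 C1 x y.
have s0 := sine_ge0 1%:M x y; have p16 : 0 < C ^+ 16 by rewrite exprn_gt0.
have c0 : 0 <= 2 * eta / k ^+ 2 by apply: divr_ge0; [apply: mulr_ge0 | exact: sqr_ge0].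
apply: le_trans (ler_wpM2l (ltW C4) (ler_wpM2l c0 sc)) _.
apply: le_trans (_ : eta * (32 * C ^+ 16) / e ^+ 2 * sine Q x y <= _).
  rewrite le_eqVlt; apply/orP; left; apply/eqP; rewrite /k.
  by field; rewrite ?gt_eqF.
rewrite ler_wpM2r ?sine_ge0 //.
rewrite ler_pdivrMr ?exprn_gt0 // -exprS.
by rewrite -ler_pdivlMr // mulr_gt0.
Qed.

End SchottkyConstants.

Section DominatedImpliesSchottky.
Variables (R : realType) (d : nat).

(** By transversality, attracting lines and repelling hyperplanes of long words are at
    distance at least delta / 2 for the standard inner product, hence at least
    delta / (2 C^4) for Q. *)
Theorem dominated_schottky (Q : 'M[R]_d) (S : set 'M[R]_d) :
  (2 <= d)%N -> inner_product_matrix Q -> relatively_compact_in_GL S ->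
  one_dominated S ->
  exists r : R, 0 < r /\ forall e : R, 0 < e -> e < r ->
    exists n0 : nat, (1 <= n0)%N /\
      schottky_family Q r e
        (\bigcup_(n in [set n : nat | (n0 <= n)%N]) set_power S n).
Proof.
move=> d2 hQ hS /(dominated_frame_exists d2 hS)[K [tau [N0 [a [u [w fr]]]]]].
have [delta [N [delta0 N0N trans]]] := transversality fr.
have [_ tau01 SGL _ frame] := fr.
have [C [C1 QC CQ]] := enorm_equiv hQ.
have C0 : 0 < C by lra.
have C4 : 0 < C ^+ 4 by rewrite exprn_gt0.
have C41 : 1 <= C ^+ 4 by rewrite exprn_ege1.
have C16 : 0 < C ^+ 16 by rewrite exprn_gt0.
exists (delta / (12 * C ^+ 4)); split; first by rewrite divr_gt0 // mulr_gt0.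
set r := _ / _ => e e0 er.
(* the bounds required by near_rank_one_attractor, close_to_dot and
   near_rank_one_contraction *)
pose eta0 := Num.min (delta ^+ 2 / 16)
  (Num.min (delta * e / (4 * C ^+ 4)) (e ^+ 3 / (32 * C ^+ 16))).
have eta0_gt0 : 0 < eta0.
  by rewrite !lt_min !divr_gt0 ?mulr_gt0 ?exprn_gt0.
have t01 : 0 <= tau < 1 by case/andP: tau01 => ? ->; rewrite ltW.
have [M hM] := expr_eventually_le t01 eta0_gt0.
exists (maxn N M).+1; split=> //; set E := \bigcup_(n in _) _.
have key g : E g -> exists n v l, [/\ (N <= n)%N, set_power S n g,
    'N(v) = 1 /\ 'N(l) = 1, attracting_line g = <[v]>%VS /\ proximal g &
  [/\ forall x, (x \in repelling_hyperplane g) = ('[l, x] == 0),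
    close_to (delta / 8) v (u g), close_to (delta / 8) l (w g),
    delta <= 1 &
    forall x y, proj fullv x -> proj fullv y ->
        e <= pdist_repelling Q x g -> e <= pdist_repelling Q y g ->
        pdist Q (lin g @: x) (lin g @: y) <= e * pdist Q x y]].
  case=> n /= Mn gn.
  have Nn : (N <= n)%N by rewrite (leq_trans _ (ltnW Mn)) // leq_maxl.
  have nearg := frame _ _ (leq_trans N0N Nn) gn.
  have [[ag [uu ww]] _ _ _ _] := nearg.
  have ht : tau ^+ n <= eta0.
    by apply: hM; rewrite (leq_trans _ (ltnW Mn)) // leq_maxr.
  move: ht; rewrite !le_min => /and3P[ht1 ht2 ht3].
  have tn0 : 0 <= tau ^+ n by rewrite exprn_ge0; case/andP: t01.
  have hd := trans _ _ _ _ Nn Nn gn gn.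
  have [v [l [[nv nl] cv cl [pg attg] HE]]] :=
    near_rank_one_attractor nearg tn0 delta0 hd ht1.
  have d1 : delta <= 1.
    by apply: le_trans hd (le_trans (dot_unit_le _ ww) _); rewrite (enorm_unit uu).
  have nu8 : 2 * tau ^+ n / delta <= delta / 8 by rewrite ler_pdivrMr //; lra.
  have wk (x y : 'cV[R]_d) : close_to (2 * tau ^+ n / delta) x y -> close_to (delta / 8) x y.
    by move=> [c [q [xE hq hc hc']]]; exists c, q; split=> //; lra.
  have e1 : e <= 1.
    apply: le_trans (ltW er) _; rewrite /r ler_pdivrMr ?mulr_gt0 //; lra.
  exists n, v, l; split=> //; split=> //; try exact: wk.
  move=> X Y [X1 _] [Y1 _] hX hY.
  have [x0 XE] := vline_vpick X1; have [y0 YE] := vline_vpick Y1.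
  have ug := set_power_unit SGL gn.
  have gneq (z : 'cV[R]_d) : z != 0 -> g *m z != 0.
    by apply: contra => /eqP h; rewrite -[z](mulKmx ug) h mulmx0.
  rewrite XE YE; rewrite XE in hX; rewrite YE in hY.
  apply: (near_rank_one_contraction hQ C1 QC CQ nearg tn0 nl cl HE e0 e1) => //.
  - lra.
  - rewrite ler_pdivrMr //.
    apply: le_trans (ler_wpM2l _ ht2) _ => //.
    by rewrite le_eqVlt; apply/orP; left; apply/eqP; field; rewrite gt_eqF.
  - exact: gneq.
  - exact: gneq.
have sep g h : E g -> E h -> 6 * r <= pdist_repelling Q (attracting_line g) h.
  move=> /key[n [v [l [Nn gn [nv nl] [-> _] [_ cv _ _ _]]]]].
  move=> /key[m [v' [l' [Nm hm [nv' nl'] _ [HE _ cl _ _]]]]].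
  have -> : 6 * r = delta / 2 / C ^+ 4 by rewrite /r; field; rewrite gt_eqF.
  apply: (pdist_hyperplane_ge d2 hQ C1 QC CQ HE nv nl').
  have [[_ [uu _]] _ _ _ _] := frame _ _ (leq_trans N0N Nn) gn.
  have [[_ [_ ww]] _ _ _ _] := frame _ _ (leq_trans N0N Nm) hm.
  apply: (transverse_close_to uu ww nv _ (lexx _) cv cl).
    by rewrite divr_ge0 // ltW.
  exact: trans Nm Nn hm gn.
have r0 : 0 < r by rewrite divr_gt0 // mulr_gt0.
split; last exact: sep.
move=> g Eg; have [n [v [l [_ _ _ [_ pg] [_ _ _ _ hcontr]]]]] := key g Eg.
split=> //; apply: le_trans (sep g g Eg Eg); rewrite ler_pM2r //.
by rewrite ler_nat.
Qed.

End DominatedImpliesSchottky.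

(** * From Schottky families to domination *)

Section ProximalEigenline.
Variables (R : realType) (d : nat).
Implicit Types (g : 'M[R]_d).

Lemma eigenvalues_conj g z : z \in eigenvalues g -> conjc z \in eigenvalues g.
Proof.
rewrite !mem_eigenvalues -map_char_poly => /rootP h; apply/rootP.
have -> : map_poly (real_complex R) (char_poly g) =
    map_poly (@conjc R) (map_poly (real_complex R) (char_poly g)).
  by apply/polyP => i; rewrite !coef_map /= oppr0.
by rewrite horner_map h rmorph0.
Qed.

(** The conjugate eigenvalue has the same modulus, so it is the same eigenvalue. *)
Lemma dominant_eigenvalue_real g z : dominant_eigenvalue g z ->
  z = real_complex R (complex.Re z).
Proof.
case=> s [hp hs].
have : conjc z \in eigenvalues g.
  by apply: eigenvalues_conj; rewrite (perm_mem hp) mem_head.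
rewrite (perm_mem hp) inE => /orP[/eqP|/hs]; last by rewrite normcJ ltxx.
case: z {hp hs} => x y [] /eqP; rewrite -subr_eq0 -opprD oppr_eq0 -mulr2n.
by rewrite mulrn_eq0 /= => /eqP ->.
Qed.

(** The dominant eigenvalue is real, so it has a real eigenvector and the eigenspace chosen
    by [attracting_line] is not zero. *)
Lemma proximal_eigenvector g : proximal g ->
  vpick (attracting_line g) != 0 /\
  exists a : R, g *m vpick (attracting_line g) = a *: vpick (attracting_line g).
Proof.
case=> z hz; have zE := dominant_eigenvalue_real hz; rewrite zE in hz.
have ex : [set L | exists a : R, dominant_eigenvalue g (real_complex R a) /\
    L = passmx.leigenspace (lin g) a] (passmx.leigenspace (lin g) (complex.Re z)).
  by exists (complex.Re z).
have [a [ha La]] := xgetPex 0%VS (ex_intro _ _ ex).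
rewrite -/(attracting_line g) in La.
have mem x : (x \in attracting_line g) = (g *m x == a *: x).
  rewrite La /passmx.leigenspace memv_ker add_lfunE opp_lfunE scale_lfunE.
  by rewrite id_lfunE /lin lfunE /= subr_eq0.
split; last by exists a; apply/eqP; rewrite -mem memv_pick.
rewrite vpick0; apply/eqP => L0.
have [v nv gv] : exists2 v : 'cV[R]_d, 'N(v) = 1 & g *m v = a *: v.
  apply: real_eigenvector; rewrite -(fmorph_root (real_complex R)) map_char_poly.
  by rewrite -mem_eigenvalues; case: ha => s [hp _]; rewrite (perm_mem hp) mem_head.
have : v \in attracting_line g by rewrite mem gv.
by rewrite L0 memv0 -(enorm_eq0 ip1) nv oner_eq0.
Qed.

End ProximalEigenline.

Section SchottkyDynamics.
Variables (R : realType) (d : nat) (Q : 'M[R]_d) (r e : R) (T : set 'M[R]_d).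
Hypotheses (hQ : inner_product_matrix Q) (Tunit : T `<=` GL).
Hypotheses (e0 : 0 < e) (er : e <= r) (hT : schottky_family Q r e T).
Implicit Types (g h : 'M[R]_d) (x y : 'cV[R]_d).

Let r0 : 0 < r. Proof. exact: lt_le_trans e0 er. Qed.

Local Notation D g x := (pdist_repelling Q <[x]>%VS g).
Local Notation att g := (vpick (attracting_line g)).

Let att_neq0 g : T g -> att g != 0.
Proof. by case: hT => /(_ g) h _ /h[/proximal_eigenvector[]]. Qed.

Lemma image_neq0 g x : T g -> x != 0 -> g *m x != 0.
Proof.
move=> /Tunit ug; apply: contra => /eqP h.
by rewrite -[x](mulKmx ug) h mulmx0.
Qed.

Lemma attracting_separated g h : T g -> T h -> 6 * r <= D h (att g).
Proof.
move=> Tg Th; apply: le_trans (proj2 hT g h Tg Th) _.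
rewrite le_eqVlt; apply/orP; left; apply/eqP.
congr (inf (image _ _)); apply/funext => M; rewrite /pdist.
have [k k0 kE] := vpick_vline (att_neq0 Tg).
by rewrite -!/(sine _ _ _) kE -[in RHS](scale1r (vpick M)) (sineZ hQ) ?oner_eq0.
Qed.

Lemma hyperplane_inhabited g : T g ->
  exists2 y, y != 0 & y \in repelling_hyperplane g.
Proof.
move=> Tg; have h := attracting_separated Tg Tg; apply: contrapT => hn.
suff : D g (att g) = 0 by move=> h0; move: h; rewrite h0; have := r0; lra.
rewrite /pdist_repelling /pdist_set (_ : proj _ = set0) ?image_set0 ?inf0 //.
rewrite -subset0 => M [M1 MH]; apply: hn.
have [p0 _] := vline_vpick M1; exists (vpick M) => //.
by apply: (subvP MH); exact: memv_pick.
Qed.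

Lemma pdist_repelling_lipschitz g x y : T g -> x != 0 -> y != 0 ->
  D g x - sine Q x y <= D g y.
Proof.
move=> Tg x0 y0; apply: pdist_set_ge => //; first exact: hyperplane_inhabited.
move=> m m0 mH; rewrite lerBlDr addrC.
exact: le_trans (pdist_set_le hQ x0 m0 mH) (sine_triangle hQ x0 y0 m0).
Qed.

(** Here every element of T contracts distances by e. *)
Definition contracting_domain x : Prop := forall g, T g -> e <= D g x.

Lemma near_attracting_in_domain g x : T g -> x != 0 ->
  sine Q (att g) x <= r -> contracting_domain x.
Proof.
move=> Tg x0 hx h Th.
have := pdist_repelling_lipschitz Th (att_neq0 Tg) x0.
by have := attracting_separated Tg Th; have := r0; have := er; lra.
Qed.

Lemma schottky_contracts g x y : T g -> x != 0 -> y != 0 ->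
  e <= D g x -> e <= D g y -> sine Q (g *m x) (g *m y) <= e * sine Q x y.
Proof.
move=> Tg x0 y0 hx hy; have [_ _ h] := proj1 hT g Tg.
have pl (z : 'cV[R]_d) : z != 0 -> proj fullv <[z]>%VS.
  by move=> z0; apply: proj_vline; rewrite ?memvf.
have := h _ _ (pl x x0) (pl y y0) hx hy.
by rewrite !limg_line /lin !lfunE /= !pdist_vline // image_neq0.
Qed.

(** The line of g x is within e of the attracting line of g, which is at distance at
    least 6 r from every repelling hyperplane. *)
Lemma contracting_domain_invariant g x : T g -> x != 0 ->
  contracting_domain x -> contracting_domain (g *m x).
Proof.
move=> Tg x0 hx; have v0 := att_neq0 Tg.
have [[_ [a ga]] h2] : (att g != 0 /\ exists a, g *m att g = a *: att g) /\ e <= D g (att g).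
  split; first by apply: proximal_eigenvector; case: (proj1 hT g Tg).
  by have := attracting_separated Tg Tg; have := r0; have := er; lra.
have a0 : a != 0.
  apply: contraNneq (image_neq0 Tg v0) => a0.
  by rewrite ga a0 scale0r.
apply: (near_attracting_in_domain Tg); first exact: image_neq0.
rewrite -(sineZ hQ _ _ a0 (oner_neq0 R)) scale1r -ga.
apply: le_trans (schottky_contracts Tg v0 x0 h2 (hx g Tg)) _.
apply: le_trans er; rewrite ler_piMr ?(ltW e0) //; exact: sine_le1.
Qed.

End SchottkyDynamics.

Section SingularValueRatio.
Variables (R : realType) (d : nat).
Implicit Types (g : 'M[R]_d) (x y z : 'cV[R]_d).

(** This compares the standard inner product with its pullback, of Gram matrix g^T g. *)
Lemma bilipschitz_sine (K : R) g x y : 1 <= K -> g \in unitmx -> bilipschitz K g ->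
  sine 1%:M (g *m x) (g *m y) <= K ^+ 4 * sine 1%:M x y.
Proof.
move=> K1 ug hg; pose Q := g^T *m g.
have dE z t : dot Q z t = '[g *m z, g *m t].
  by rewrite standard_dotE trmx_mul /dot /Q !mulmxA.
have nE z : enorm Q z = 'N(g *m z) by rewrite /enorm dE.
have hQ : inner_product_matrix Q.
  split=> [|z z0]; first by rewrite /Q trmx_mul trmxK.
  rewrite dE (proj2 ip1) //; apply: contra z0 => /eqP h.
  by rewrite -[z](mulKmx ug) h mulmx0.
have -> : sine 1%:M (g *m x) (g *m y) = sine Q x y.
  by rewrite /sine /wedge_norm !dE !nE.
by apply: (sine_compare hQ ip1 K1) => z; rewrite nE; case: (hg z).
Qed.

(** Move v by rho along e1 to get x and along e2 to get y, choosing signs so that the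
    determinant of the (e1, e2)-coordinates of x and y is at least rho^2. The area of
    g x /\ g y is then at least s1 s2 rho^2 / 2, while its sides have length at most
    2 s1. *)
Lemma singular_ratio_le g v (rho A : R) : (2 <= d)%N -> g \in unitmx ->
  'N(v) = 1 -> 0 < rho -> rho <= 1 / 2 ->
  (forall x y, x != 0 -> y != 0 -> 'N(x - v) <= rho -> 'N(y - v) <= rho ->
     sine 1%:M (g *m x) (g *m y) <= A) ->
  singular_value 2 g / singular_value 1 g <= 8 / rho ^+ 2 * A.
Proof.
move=> d2 ug nv rho0 rho1 hA.
have [e1 [e2 /= [[e11 e22 e12] [a1 a2 _] ge1 ge2 [h1 _]]]] := singular_vectors g d2.
set s1 := singular_value 1 g in a1 ge1 h1 *; set s2 := singular_value 2 g in a2 ge2 *.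
pose sg (c : R) := if 0 <= c then rho else - rho.
have sgN c : `|sg c| = rho.
  by rewrite /sg; case: ifP; rewrite ?normrN gtr0_norm.
have sgM c : sg c * c = rho * `|c|.
  rewrite /sg; case: ifP => [c0|/negbT]; first by rewrite ger0_norm.
  by rewrite -ltNge => c0; rewrite ltr0_norm // mulrN mulNr.
pose x := v + sg '[e1, v] *: e1; pose y := v + sg '[e2, v] *: e2.
have nxv : 'N(x - v) = rho.
  by rewrite /x addrC addKr (enormZ ip1) (enorm_unit e11) mulr1 sgN.
have nyv : 'N(y - v) = rho.
  by rewrite /y addrC addKr (enormZ ip1) (enorm_unit e22) mulr1 sgN.
have nz z : 'N(z - v) = rho -> 1 / 2 <= 'N(z) /\ 'N(z) <= 2.
  move=> hz; have vz : v + (z - v) = z by rewrite addrC subrK.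
  have := enorm_rev ip1 v (z - v); have := enormD ip1 v (z - v).
  by rewrite vz nv hz => *; split; lra.
have [x1 x2] := nz _ nxv; have [y1 y2] := nz _ nyv.
have neq0 z : 1 / 2 <= 'N(z) -> z != 0 by move=> hz; rewrite -(enorm_gt0 ip1); lra.
have x0 := neq0 _ x1; have y0 := neq0 _ y1.
have hs := hA x y x0 y0; rewrite nxv nyv in hs; have {}hs := hs (lexx _) (lexx _).
set W := wedge_norm 1%:M (g *m x) (g *m y).
have gneq z : z != 0 -> 0 < 'N(g *m z).
  move=> z0; rewrite (enorm_gt0 ip1); apply: contra z0 => /eqP h.
  by rewrite -[z](mulKmx ug) h mulmx0.
have ngx := gneq _ x0; have ngy := gneq _ y0.
have s1_gt0 : 0 < s1.
  by have := lt_le_trans ngx (h1 x); rewrite pmulr_lgt0 //; rewrite (enorm_gt0 ip1).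
have A0 : 0 <= A by apply: le_trans hs; exact: sine_ge0.
have hW : W <= 4 * s1 ^+ 2 * A.
  have : W <= A * ('N(g *m x) * 'N(g *m y)).
    by rewrite -ler_pdivrMr ?mulr_gt0.
  move/le_trans; apply; rewrite mulrC ler_wpM2r //.
  apply: le_trans (_ : (s1 * 2) * (s1 * 2) <= _); last first.
    by rewrite le_eqVlt; apply/orP; left; apply/eqP; ring.
  apply: ler_pM; rewrite ?enorm_ge0 //.
    by apply: le_trans (h1 _) _; rewrite ler_pM2l.
  by apply: le_trans (h1 _) _; rewrite ler_pM2l.
have d1 z : '[g *m e1, g *m z] = s1 ^+ 2 * '[e1, z].
  by rewrite dotC ?dot_trmx ?ge1 ?dotZr ?(dotC ip1 z) //; exact: ip1.
have d2' z : '[g *m e2, g *m z] = s2 ^+ 2 * '[e2, z].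
  by rewrite dotC ?dot_trmx ?ge2 ?dotZr ?(dotC ip1 z) //; exact: ip1.
have n1 : 'N(g *m e1) <= s1 by have := h1 e1; rewrite (enorm_unit e11) mulr1.
have n2 : 'N(g *m e2) = s2.
  apply/eqP; rewrite -(@eqrXn2 _ 2) ?enorm_ge0 // (enorm_sq ip1) d2' e22.
  by rewrite mulr1.
pose D := '[e1, x] * '[e2, y] - '[e1, y] * '[e2, x].
have hD : rho ^+ 2 <= `|D|.
  have e21 : '[e2, e1] = 0 by rewrite (dotC ip1) e12.
  have -> : D = sg '[e1, v] * '[e2, v] + sg '[e2, v] * '[e1, v] + sg '[e1, v] * sg '[e2, v].
    by rewrite /D /x /y !dotDr !dotZr e11 e22 e12 e21; ring.
  set c1 := '[e1, v]; set c2 := '[e2, v].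
  have : rho ^+ 2 * rho ^+ 2 <= `|sg c1 * c2 + sg c2 * c1 + sg c1 * sg c2| * rho ^+ 2.
    have -> : `|sg c1 * c2 + sg c2 * c1 + sg c1 * sg c2| * rho ^+ 2 =
      `|(sg c1 * c2 + sg c2 * c1 + sg c1 * sg c2) * (sg c1 * sg c2)|.
      by rewrite normrM [in RHS]normrM !sgN expr2.
    apply: le_trans (ler_norm _).
    have q1 : sg c1 * sg c1 = rho ^+ 2 by rewrite -expr2 -real_normK ?num_real ?sgN.
    have q2 : sg c2 * sg c2 = rho ^+ 2 by rewrite -expr2 -real_normK ?num_real ?sgN.
    have -> : (sg c1 * c2 + sg c2 * c1 + sg c1 * sg c2) * (sg c1 * sg c2) =
       (sg c1 * sg c1) * (sg c2 * c2) + (sg c2 * sg c2) * (sg c1 * c1) +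
       (sg c1 * sg c1) * (sg c2 * sg c2) by ring.
    have p c : 0 <= rho ^+ 2 * (rho * `|c|).
      by rewrite mulr_ge0 ?sqr_ge0 // mulr_ge0 // ltW.
    by rewrite q1 q2 !sgM lerDr addr_ge0.
  by rewrite ler_pM2r // exprn_gt0.
pose z := '[e1, x] *: (g *m y) - '[e1, y] *: (g *m x).
have hc : s1 ^+ 2 * 'N(z) <= 2 * 'N(g *m e1) * W.
  have := wedge_contract ip1 (g *m e1) (g *m x) (g *m y); rewrite !d1 -/W.
  have -> : (s1 ^+ 2 * '[e1, x]) *: (g *m y) - (s1 ^+ 2 * '[e1, y]) *: (g *m x) =
    s1 ^+ 2 *: z by rewrite /z scalerBr !scalerA.
  by rewrite (enormZ ip1) ger0_norm ?sqr_ge0.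
have hz : s2 ^+ 2 * D = '[g *m e2, z].
  by rewrite /z dotDr dotNr !dotZr !d2' /D; ring.
have hz' : s2 ^+ 2 * `|D| <= s2 * 'N(z).
  rewrite -n2; have := cauchy_schwarz ip1 (g *m e2) z; rewrite -hz normrM.
  by rewrite ger0_norm ?sqr_ge0 // n2.
have fin : s1 * s2 * `|D| <= 2 * W.
  have [s20|s20] := eqVneq s2 0.
    by rewrite s20 mulr0 mul0r mulr_ge0 // wedge_ge0.
  have s2_gt0 : 0 < s2 by rewrite lt0r s20.
  have b1 : s2 * `|D| <= 'N(z) by rewrite -(ler_pM2l s2_gt0) mulrA -expr2.
  have b2 : s1 * 'N(z) <= 2 * W.
    rewrite -(ler_pM2l s1_gt0) mulrA -expr2; apply: le_trans hc _.
    rewrite [leRHS]mulrA [s1 * 2]mulrC ler_wpM2r ?wedge_ge0 //.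
    by rewrite ler_pM2l.
  by apply: le_trans b2; rewrite -mulrA ler_pM2l.
rewrite ler_pdivrMr // -(ler_pM2l s1_gt0).
have rr : 0 < rho ^+ 2 by rewrite exprn_gt0.
have : s1 * s2 * rho ^+ 2 <= 8 * s1 ^+ 2 * A.
  apply: le_trans (_ : s1 * s2 * `|D| <= _).
    by rewrite ler_wpM2l // mulr_ge0 // ltW.
  by apply: le_trans fin _; lra.
rewrite -ler_pdivlMr // => /le_trans; apply.
by rewrite le_eqVlt; apply/orP; left; apply/eqP; field; rewrite gt_eqF.
Qed.

End SingularValueRatio.

Section SchottkyImpliesDominated.
Variables (R : realType) (d : nat).

Lemma bernoulli_le (x : R) n : 0 <= x <= 1 -> 1 - n%:R * x <= (1 - x) ^+ n.
Proof.
move=> /andP[x0 x1]; elim: n => [|n IH]; first by rewrite mul0r subr0 expr0.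
rewrite exprS; have h : 0 <= 1 - x by lra.
apply: le_trans (ler_wpM2l h IH); rewrite -natr1.
have : 0 <= n%:R * x * x by rewrite !mulr_ge0.
by set m := n%:R; lra.
Qed.

(** A word of length n k + j is a word h of length j after k elements of S^n. The first k
    elements contract a fixed ball around an attracting line by e^k, and h changes angles
    by a factor bounded in terms of n. *)
Theorem schottky_dominated (Q : 'M[R]_d) (S : set 'M[R]_d) (n : nat) (r e : R) :
  (2 <= d)%N -> inner_product_matrix Q -> relatively_compact_in_GL S ->
  (1 <= n)%N -> 0 < e -> e <= r -> schottky_family Q r e (set_power S n) ->
  one_dominated S.
Proof.
move=> d2 hQ hS n0 e0 er hT.
have [K K1 hK] := relatively_compact_bilipschitz hS; have K0 : 0 < K by lra.
have [C [C1 QC CQ]] := enorm_equiv hQ; have C0 : 0 < C by lra.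
have C4 : 0 < C ^+ 4 by rewrite exprn_gt0.
have SGL : S `<=` GL by case: hS.
have TGL : set_power S n `<=` GL by move=> g; exact: set_power_unit.
have r0 : 0 < r by lra.
have [[s Ss]|nS] := pselect (exists s, S s); last first.
  exists 1; split=> //; exists 1%N => // -[//|m] _ g /set_powerS[s [b [Ss _ _]]].
  by case: nS; exists s.
have [g0 Tg0] := @set_power_nonempty R d S n (ex_intro _ s Ss).
pose v0 := vpick (attracting_line g0).
have v0_neq0 : v0 != 0 by case: (proximal_eigenvector (let: And3 p _ _ := proj1 hT g0 Tg0 in p)).
(* sines are at most 1, and 6 r is a lower bound for some of them *)
have e16 : e <= 1 / 6.
  have [y y0 yH] := hyperplane_inhabited hQ e0 er hT Tg0.
  have := le_trans (attracting_separated hQ hT Tg0 Tg0) (pdist_set_le hQ v0_neq0 y0 yH).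
  by have := sine_le1 hQ v0 y; lra.
pose rho := Num.min (1 / 2) (r / (2 * C ^+ 4)).
have rho0 : 0 < rho by rewrite lt_min; apply/andP; split; [lra | rewrite divr_gt0 // mulr_gt0].
have rho1 : rho <= 1 / 2 by rewrite ge_min lexx.
have rho2 : rho <= r / (2 * C ^+ 4) by rewrite ge_min lexx orbT.
have nv0 : 0 < 'N(v0) by rewrite (enorm_gt0 ip1).
pose v := 'N(v0)^-1 *: v0.
have nv : 'N(v) = 1.
  by rewrite /v (enormZ ip1) gtr0_norm ?invr_gt0 // mulVf // gt_eqF.
have v_neq0 : v != 0 by rewrite -(enorm_gt0 ip1) nv.
have dom x : x != 0 -> 'N(x - v) <= rho -> contracting_domain Q e (set_power S n) x.
  move=> x0 hx; apply: (near_attracting_in_domain hQ e0 er hT Tg0 x0).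
  have nx : 1 / 2 <= 'N(x).
    by have := enorm_rev ip1 v (x - v); rewrite [v + _]addrC subrK nv; lra.
  rewrite -/v0 -(sineZ hQ v0 x (invr_neq0 (lt0r_neq0 nv0)) (oner_neq0 R)) scale1r -/v.
  rewrite (sineC hQ).
  apply: le_trans (sine_compare hQ ip1 C1 QC CQ x v) _.
  have := sine_le_height ip1 x 1 v_neq0; rewrite scale1r => h.
  apply: le_trans (ler_wpM2l (ltW C4) h) _.
  apply: le_trans (_ : C ^+ 4 * (2 * rho) <= _).
    rewrite ler_wpM2l ?(ltW C4) // ler_pdivrMr; last by lra.
    by apply: le_trans hx _; have := ler_wpM2l (ltW rho0) nx; lra.
  have := ler_wpM2l (ltW C4) rho2.
  have -> : C ^+ 4 * (r / (2 * C ^+ 4)) = r / 2 by field; rewrite gt_eqF.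
  lra.
have iter k b x y : x != 0 -> y != 0 ->
    contracting_domain Q e (set_power S n) x -> contracting_domain Q e (set_power S n) y ->
    set_power S (n * k) b ->
    [/\ contracting_domain Q e (set_power S n) (b *m x),
        contracting_domain Q e (set_power S n) (b *m y),
        b *m x != 0, b *m y != 0 & sine Q (b *m x) (b *m y) <= e ^+ k].
  move=> x0 y0 hx hy; elim: k b => [|k IH] b.
    by rewrite muln0 => /set_power0 ->; rewrite !mul1mx; split=> //; exact: sine_le1.
  rewrite mulnS => /set_power_split[t [c [Tt /IH[cx cy cx0 cy0 hc] ->]]].
  rewrite -!mulmxA; split.
  - exact: (contracting_domain_invariant hQ TGL e0 er hT).
  - exact: (contracting_domain_invariant hQ TGL e0 er hT).
  - exact: (image_neq0 TGL).
  - exact: (image_neq0 TGL).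
  apply: le_trans (schottky_contracts hQ TGL hT Tt cx0 cy0 (cx t Tt) (cy t Tt)) _.
  by rewrite exprS ler_pM2l.
pose A := 8 / rho ^+ 2 * ((K ^+ n) ^+ 4 * C ^+ 4).
have A0 : 0 < A by rewrite !mulr_gt0 ?invr_gt0 ?exprn_gt0.
have ratio k j g : (j <= n)%N -> set_power S (j + n * k) g ->
    singular_value 2 g / singular_value 1 g <= A * e ^+ k.
  move=> jn hg; have ug := set_power_unit SGL hg.
  rewrite /A -mulrA; apply: (singular_ratio_le d2 ug nv rho0 rho1).
  have [h [b [hh hb ->]]] := set_power_split hg.
  move=> x y x0 y0 hx hy.
  have [_ _ _ _ hc] := iter k b x y x0 y0 (dom _ x0 hx) (dom _ y0 hy) hb.
  rewrite -!mulmxA.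
  have hbil := set_power_bilipschitz K1 hK hh.
  have Kj1 : 1 <= K ^+ j by rewrite exprn_ege1.
  apply: le_trans (bilipschitz_sine _ _ Kj1 (set_power_unit SGL hh) hbil) _.
  have Kj0 : 0 <= K ^+ j by rewrite exprn_ge0 // ltW.
  have Kn0 : 0 <= K ^+ n by rewrite exprn_ge0 // ltW.
  rewrite -[leRHS]mulrA; apply: ler_pM.
  - exact: exprn_ge0.
  - exact: sine_ge0.
  - by rewrite lerXn2r ?nnegrE // ler_weXn2l.
  apply: le_trans (sine_compare ip1 hQ C1 CQ QC _ _) _.
  by rewrite ler_pM2l.
have t01 : 0 <= (2 / 9 : R) < 1 by apply/andP; split; lra.
have cA : 0 < 3 / 4 / A by rewrite divr_gt0 //; lra.
have [k0 hk0] := expr_eventually_le t01 cA.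
have nR : 1 <= n%:R :> R by rewrite ler1n.
(* (1 - x)^n is at least 3/4, so (1 - x)^(n (k + 1)) exceeds A e^k for large k, as
   e <= 1/6 = 2/9 * 3/4 *)
pose x : R := (4 * n%:R)^-1.
have nx : n%:R * x = 1 / 4 by rewrite /x; field; rewrite gt_eqF //; lra.
have x0 : 0 < x by rewrite /x invr_gt0; lra.
have x1 : x <= 1 by have := ler_wpM2r (ltW x0) nR; rewrite nx; lra.
have qn : 3 / 4 <= (1 - x) ^+ n.
  by have := @bernoulli_le x n; rewrite nx (ltW x0) x1 => /(_ isT); lra.
exists x; split=> //; exists (n * k0)%N => // m /= hm g gm.
pose k := (m %/ n)%N; pose j := (m %% n)%N.
have em : m = (j + n * k)%N by rewrite /j /k addnC mulnC -divn_eq.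
have jn : (j <= n)%N by rewrite ltnW // ltn_mod.
have kk0 : (k0 <= k)%N by rewrite /k leq_divRL // mulnC.
rewrite {1}em in gm; apply: le_trans (ratio k j g jn gm) _.
have y0 : 0 <= 1 - x by lra.
apply: le_trans (_ : (1 - x) ^+ (n * k.+1) <= _); last first.
  apply: ler_wiXn2l => //; first by lra.
  by rewrite em mulnS leq_add2r.
rewrite exprM; apply: le_trans (_ : (3 / 4) ^+ k.+1 <= _); last first.
  by rewrite lerXn2r ?nnegrE ?exprn_ge0 //; lra.
apply: le_trans (_ : A * (1 / 6) ^+ k <= _).
  rewrite ler_pM2l // lerXn2r ?nnegrE ?(ltW e0) //; lra.
have -> : (1 / 6 : R) = 2 / 9 * (3 / 4) by field.
rewrite exprMn mulrA exprS ler_wpM2r ?exprn_ge0 //; first by lra.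
by have := hk0 k kk0; rewrite ler_pdivlMr // mulrC.
Qed.

End SchottkyImpliesDominated.

Theorem proposition4p8 (R : realType) (d : nat) (hd : (2 <= d)%N)
    (Q : 'M[R]_d) (hQ : inner_product_matrix Q)
    (S : set 'M[R]_d) (hS : relatively_compact_in_GL S) :
  ((exists (n : nat) (r e : R),
      [/\ (1 <= n)%N, 0 < e, e <= r & schottky_family Q r e (set_power S n)]) ->
   one_dominated S) /\
  (one_dominated S ->
   exists r : R, 0 < r /\
     forall e : R, 0 < e -> e < r ->
       exists n0 : nat, (1 <= n0)%N /\
         schottky_family Q r e
           (\bigcup_(n in [set n : nat | (n0 <= n)%N]) set_power S n)).
Proof.
split; last exact: dominated_schottky.
by case=> n [r [e [n1 e0 er hT]]]; exact: (schottky_dominated hd hQ hS n1 e0 er hT).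
Qed.
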